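(* Let $G(s)$ be an $m\times m$ real-rational proper negative imaginary transfer function matrix and let $H(s)$ be an $m\times m$ real-rational proper strictly negative imaginary transfer function matrix, and assume that $G(\infty)H(\infty)=0$ and $H(\infty)\geq 0$. Then the positive feedback interconnection of $G(s)$ and $H(s)$ is internally stable if and only if $\lambda_{\max}(G(0)H(0))<1$.
   Context: For Hermitian matrices, $X\ge 0$ (resp. $X>0$) means positive semidefinite (resp. positive definite); $X^{*}$ is the conjugate transpose; $j=\sqrt{-1}$; $G(\infty)=\lim_{s\to\infty}G(s)$. $\lambda_{\max}(\cdot)$ denotes the maximum eigenvalue of a matrix with only real eigenvalues. Negative imaginary (NI): a square transfer function matrix $G(s)$ is NI if (1) $G(s)$ has no pole at the origin and no pole in $\operatorname{Re}[s]>0$; (2) for all $\omega>0$ such that $j\omega$ is not a pole of $G(s)$, $j\left(G(j\omega)-G(j\omega)^{*}\right)\ge 0$; (3) if $j\omega_0$, with $\omega_0\in(0,\infty)$, is a pole of $G(s)$, then it is at most a simple pole and the matrix $K_0=\lim_{s\to j\omega_0}(s-j\omega_0)\,s\,G(s)$ is positive semidefinite Hermitian. Strictly negative imaginary (SNI): a square real-rational transfer function matrix $H(s)$ is SNI if (1) $H(s)$ has no poles in $\operatorname{Re}[s]\ge 0$; (2) $j\left[H(j\omega)-H(j\omega)^{*}\right]>0$ for all $\omega\in(0,\infty)$. Positive feedback interconnection and internal stability: let $(A_1,B_1,C_1,D_1)$ and $(A_2,B_2,C_2,D_2)$ be minimal real state-space realizations of $G(s)$ and $H(s)$ respectively, i.e.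 $\dot x_i=A_ix_i+B_iu_i$, $y_i=C_ix_i+D_iu_i$ for $i=1,2$. The positive feedback interconnection is obtained by setting $u_1=y_2$ and $u_2=y_1$. When $G(\infty)H(\infty)=D_1D_2=0$ (so that also $D_2D_1=0$, since $D_1,D_2$ are symmetric for NI and SNI systems), the closed-loop system is $\dot x=\breve A x$ with $x=(x_1,x_2)$ and $$\breve A=\begin{bmatrix} A_1+B_1D_2C_1 & B_1C_2\\ B_2C_1 & A_2+B_2D_1C_2\end{bmatrix}.$$ The interconnection is internally stable if all eigenvalues of $\breve A$ lie in the open left half plane. *)

(* Defs.v *)
From HB Require Import structures.
From mathcomp Require Import all_boot all_order all_algebra.
From mathcomp Require Import boolp classical_sets reals topology normedtype.
From mathcomp Require Import complex.

Set Implicit Arguments.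
Unset Strict Implicit.
Unset Printing Implicit Defensive.

Import Order.TTheory GRing.Theory Num.Theory.
Import numFieldNormedType.Exports.

Local Open Scope classical_set_scope.
Local Open Scope ring_scope.
Local Open Scope complex_scope.
Local Open Scope sesquilinear_scope.

(* Scalar real-rational functions are elements of {fraction {poly R}}.  The
   representative chosen by the quotient need not be reduced, hence the
   division by the gcd; poles are the complex roots of the reduced
   denominator. *)
Section RationalFunction.
Variable R : realType.
Implicit Types (f : {fraction {poly R}}) (s : R[i]).

Definition rnum f : {poly R} :=
  let x := repr f in \n_x %/ gcdp \n_x \d_x.

Definition rden f : {poly R} :=
  let x := repr f in \d_x %/ gcdp \n_x \d_x.

Definition polyRC (p : {poly R}) : {poly R[i]} := map_poly (real_complex R) p.

Definition rproper f : bool := (size (rnum f) <= size (rden f))%N.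

Definition pole_order f s : nat := mup s (polyRC (rden f)).

(* Meaningful when s is not a pole of f. *)
Definition reval f s : R[i] := (polyRC (rnum f)).[s] / (polyRC (rden f)).[s].

Lemma rden_neq0 f : rden f != 0.
Proof.
rewrite /rden /=; set x := repr f.
have d0 : \d_x != 0 by exact: denom_ratioP.
by rewrite dvdp_div_eq0 ?dvdp_gcdr.
Qed.

Lemma coprime_rnum_rden f : coprimep (rnum f) (rden f).
Proof.
apply: coprimep_div_gcd; apply/orP; right; exact: denom_ratioP.
Qed.

Lemma rnum_rden f : f = tofrac (rnum f) / tofrac (rden f).
Proof.
have d0 := rden_neq0 f.
apply: (@mulIf _ (tofrac (rden f))); first by rewrite tofrac_eq0.
rewrite divfK ?tofrac_eq0 //.
move: d0; rewrite /rnum /rden /=; set x := repr f => d0.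
have dx0 : \d_x != 0 by exact: denom_ratioP.
set g := gcdp _ _ in d0 *.
have g0 : g != 0 by rewrite gcdp_eq0 negb_and dx0 orbT.
have nE : \n_x %/ g * g = \n_x by rewrite divpK // dvdp_gcdl.
have dE : \d_x %/ g * g = \d_x by rewrite divpK // dvdp_gcdr.
have fE : f * tofrac \d_x = tofrac \n_x.
  rewrite -[f]reprK -/x; unlock tofrac.
  rewrite -[LHS]FracField.pi_mul /FracField.mulf.
  apply/eqP; rewrite FracField.equivf_def.
  by rewrite !numden_Ratio ?oner_neq0 ?mulf_neq0 ?oner_neq0 // !mulr1 mulrC.
apply: (@mulIf _ (tofrac g)); first by rewrite tofrac_eq0.
by rewrite -mulrA -!tofracM nE dE fE.
Qed.

End RationalFunction.

(* The filter of neighbourhoods of the point at infinity of the complex plane. *)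
Definition cinfty_nbhs (R : realType) : set_system R[i] :=
  [set A | exists M : R, forall s : R[i], M%:C < `|s| -> A s].
Arguments cinfty_nbhs R : clear implicits.

#[global] Instance cinfty_nbhs_filter (R : realType) :
  ProperFilter (cinfty_nbhs R).
Proof.
split=> [[M /(_ `|M + 1|%:C)]|].
  apply; rewrite normc_def /= expr0n /= addr0 sqrtr_sqr normr_id ltcR.
  by rewrite (lt_le_trans _ (ler_norm _)) // ltrDl ltr01.
split=> [|P Q [M PM] [N QN]|P Q PQ [M PM]].
- by exists 0.
- exists (Num.max M N) => s; rewrite /= => Ms; split; [apply: PM|apply: QN];
  by apply: le_lt_trans Ms; rewrite lecR le_max lexx ?orbT.
- by exists M => s /PM /PQ.
Qed.

Section TransferMatrix.
Variable R : realType.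
Notation tfmatrix m := 'M[{fraction {poly R}}]_m.

Definition tf_proper m (G : tfmatrix m) : Prop := forall k l, rproper (G k l).

Definition tf_pole m (G : tfmatrix m) (s : R[i]) : Prop :=
  exists k l, (0 < pole_order (G k l) s)%N.

Definition tf_eval m (G : tfmatrix m) (s : R[i]) : 'M[R[i]]_m :=
  \matrix_(k, l) reval (G k l) s.

(* The topology on the complex numbers is carried by the regular algebra
   R[i]^o. *)
Definition tf_infty m (G : tfmatrix m) : 'M[R[i]]_m :=
  \matrix_(k, l) (lim ((reval (G k l) s : R[i]^o) @[s --> cinfty_nbhs R])).

Definition psdmx m (X : 'M[R[i]]_m) : Prop :=
  X \is hermsymmx /\ forall v : 'cV[R[i]]_m, 0 <= (v ^t* *m X *m v) 0 0.

Definition pdmx m (X : 'M[R[i]]_m) : Prop :=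
  X \is hermsymmx /\
  forall v : 'cV[R[i]]_m, v != 0 -> 0 < (v ^t* *m X *m v) 0 0.

Definition jomega (w : R) : R[i] := 0 +i* w.

Definition negative_imaginary m (G : tfmatrix m) : Prop :=
  [/\ ~ tf_pole G 0 /\ (forall s, 0 < complex.Re s -> ~ tf_pole G s),
      forall w : R, 0 < w -> ~ tf_pole G (jomega w) ->
        psdmx ('i *: (tf_eval G (jomega w) - (tf_eval G (jomega w)) ^t*))
    & forall w : R, 0 < w -> tf_pole G (jomega w) ->
        (forall k l, (pole_order (G k l) (jomega w) <= 1)%N) /\
        exists2 K0 : 'M[R[i]]_m,
          forall k l,
            ((s - (jomega w)) * s * tf_eval G s k l : R[i]^o)
              @[s --> (jomega w : R[i]^o)^'] --> (K0 k l : R[i]^o)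
        & psdmx K0].

Definition strictly_negative_imaginary m (H : tfmatrix m) : Prop :=
  (forall s, 0 <= complex.Re s -> ~ tf_pole H s) /\
  (forall w : R, 0 < w ->
     pdmx ('i *: (tf_eval H (jomega w) - (tf_eval H (jomega w)) ^t*))).

(* For matrices all of whose eigenvalues are real; the supremum is then the
   maximum of a finite set, nonempty as soon as m > 0. *)
Definition lambda_max m (X : 'M[R[i]]_m) : R :=
  sup [set x : R | eigenvalue X x%:C].

End TransferMatrix.

Notation tfmatrix R m := 'M[{fraction {poly R}}]_m.

Record state_space (R : realType) (m n : nat) := StateSpace {
  ssA : 'M[R]_n;
  ssB : 'M[R]_(n, m);
  ssC : 'M[R]_(m, n);
  ssD : 'M[R]_m
}.

Section StateSpace.
Variables (R : realType) (m : nat).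

Definition ratC (a : R) : {fraction {poly R}} := tofrac a%:P.

(* C (s I - A)^-1 B + D; char_poly_mx A is the polynomial matrix s I - A. *)
Definition ss_transfer n (S : state_space R m n) : tfmatrix R m :=
  map_mx ratC (ssC S) *m invmx (map_mx (@tofrac _) (char_poly_mx (ssA S)))
    *m map_mx ratC (ssB S) + map_mx ratC (ssD S).

Definition minimal_realization n (S : state_space R m n) (G : tfmatrix R m) :
    Prop :=
  ss_transfer S = G /\
  forall n' (S' : state_space R m n'), ss_transfer S' = G -> (n <= n')%N.

(* Positive feedback u1 = y2, u2 = y1; this is the closed-loop matrix when
   D1 D2 = 0. *)
Definition closed_loop n1 n2 (S1 : state_space R m n1)
    (S2 : state_space R m n2) : 'M[R]_(n1 + n2) :=
  block_mx (ssA S1 + ssB S1 *m ssD S2 *m ssC S1) (ssB S1 *m ssC S2)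
           (ssB S2 *m ssC S1) (ssA S2 + ssB S2 *m ssD S1 *m ssC S2).

Definition internally_stable n1 n2 (S1 : state_space R m n1)
    (S2 : state_space R m n2) : Prop :=
  forall s : R[i],
    eigenvalue (map_mx (real_complex R) (closed_loop S1 S2)) s ->
    complex.Re s < 0.

End StateSpace.

(* Main.v *)
Require Import Defs.
From HB Require Import structures.
From mathcomp Require Import all_boot all_order all_algebra.
From mathcomp Require Import boolp classical_sets reals topology normedtype.
From mathcomp Require Import complex spectral derive.
From mathcomp Require Import ring lra.

(* On the imaginary axis the NI condition says that [s (G s - G oo)] and
   [(G 0 - G s) / s] have nonnegative real part, and the axis poles of the
   second are simple with nonnegative residue; a maximum principle for rational
   functions extends both inequalities to [Re s > 0].

   Suppose [u = G(s) y], [y = H(s) u] and [Re s > 0].  The second inequality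
   bounds [Re (y^* u / s)] above by [Re (1 / s) y^* G(0) y]; applied to
   [- H^-1], which is again NI, it bounds the same quantity below by
   [Re (1 / s) y^* H(0)^-1 y].  Since [lambda_max (G(0) H(0)) < 1] means
   [G(0) < H(0)^-1], [y = 0].  Closed-loop poles on the axis are excluded by the
   strictness of the SNI condition.

   Conversely, [W = (1 - H G)^-1 H], from an input added in front of [H] to the
   output of [H], is NI, and stable if the loop is, so that
   [W(0) >= W(oo) = H(oo) >= 0].  If [G(0) H(0) u = x u] then
   [W(0) (1 - x) u = H(0) u], hence [(1 - x) u^* H(0) u >= 0]. *)

Set Implicit Arguments.
Unset Strict Implicit.
Unset Printing Implicit Defensive.

Import Order.TTheory GRing.Theory Num.Theory.
Import numFieldNormedType.Exports.

Local Open Scope classical_set_scope.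
Local Open Scope ring_scope.
Local Open Scope complex_scope.
Local Open Scope sesquilinear_scope.

(** * Limits over the complex numbers *)

(** [G s - G 0] vanishes at 0, so its quotient by [s] has a realization with the same [A], no pole
    at 0 and a limit at infinity; the maximum principle therefore applies to it. Two obstacles shape
    the proof. First, [H] may be singular at infinity, and then [- H^-1] is improper. So [H + e] is
    inverted for [e > 0], and [e] is removed by completing a square, which avoids a limit of
    inverses. Second, the hypotheses concern rational functions while stability concerns state
    matrices. Minimality turns eigenvalues of a state matrix into poles, and controllability lets a
    closed-loop eigenvector be followed through an axis pole of [G]. The inequality [G(0) < H(0)^-1]
    can be read off the spectrum because, with [H(0) = L L^*], the product [G(0) H(0)] has the
    nonzero eigenvalues of the Hermitian matrix [L^* G(0) L]. In the converse, [H(0) > 0] only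
    yields [x <= 1]; the value [x = 1] would give the closed loop a nonzero equilibrium without
    input. *)

Section Limits.
Variable R : realType.
Notation C := R[i].

Lemma nbhs_complexP (b : C) (P : set C) :
  nbhs (b : C^o) P <->
  exists2 e : R, 0 < e & forall s, `|b - s| < e%:C -> P s.
Proof.
split.
  (* The radius [e] lies in [C]; being positive in the partial order, it is real. *)
  move/(@nbhs_ballP C C^o) => [e /= e0 H]; exists (complex.Re e).
    by move: e0; rewrite ltcE /= => /andP[].
  move=> s hs; apply: H; rewrite -ball_normE /ball_ /=.
  by move: hs; rewrite RRe_real // realE (ltW e0).
move=> [e e0 H]; apply/(@nbhs_ballP C C^o); exists e%:C; rewrite /= ?ltcR //.
Qed.

(* A [Variant] since unfolding the limit would expose a product, whose
   arguments the implicit argument heuristics of the lemmas below would see. *)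
Variant tendsto (T : Type) (F : set_system T) (f : T -> C) (l : C) : Prop :=
  Tendsto of (f s : C^o) @[s --> F] --> (l : C^o).

Lemma tendstoE (T : Type) (F : set_system T) (f : T -> C) (l : C) :
  tendsto F f l <-> ((f s : C^o) @[s --> F] --> (l : C^o)).
Proof. by split=> [[]|]. Qed.

Lemma tendstoP (T : Type) (F : set_system T) (FF : Filter F) (f : T -> C) l :
  tendsto F f l <-> forall e : R, 0 < e -> F [set s | `|l - f s| < e%:C].
Proof.
split=> [[fl] e e0|H].
  apply: (fl [set s | `|l - s| < e%:C]).
  by apply/nbhs_complexP; exists e.
split=> P /nbhs_complexP[e e0 eP].
by apply: (@filterS _ F FF _ _ _ (H e e0)) => s /= /eP.
Qed.

Section TendstoFilter.
Variables (T : Type) (F : set_system T).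
Hypothesis FF : Filter F.
Implicit Types (f g : T -> C) (l : C).

Lemma tendsto_cst l : tendsto F (fun=> l) l.
Proof. by split; exact: (@cvg_cst C^o). Qed.

Lemma tendstoD f g l k : tendsto F f l -> tendsto F g k ->
  tendsto F (fun s => f s + g s) (l + k).
Proof. by case=> fl [gk]; split; exact: (@cvgD C C^o T F FF f g l k fl gk). Qed.

Lemma tendstoM f g l k : tendsto F f l -> tendsto F g k ->
  tendsto F (fun s => f s * g s) (l * k).
Proof. by case=> fl [gk]; split; exact: (@cvgM C T F FF f g l k fl gk). Qed.

Lemma tendstoZ f c l : tendsto F f l -> tendsto F (fun s => c * f s) (c * l).
Proof. exact/tendstoM/tendsto_cst. Qed.

Lemma tendstoN f l : tendsto F f l -> tendsto F (fun s => - f s) (- l).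
Proof. by case=> fl; split; exact: (@cvgN C C^o T F FF f l fl). Qed.

Lemma tendstoB f g l k : tendsto F f l -> tendsto F g k ->
  tendsto F (fun s => f s - g s) (l - k).
Proof. by move=> fl /tendstoN; apply: tendstoD. Qed.

Lemma tendstoV f l : l != 0 -> tendsto F f l ->
  tendsto F (fun s => (f s)^-1) l^-1.
Proof. by move=> l0 [fl]; split; exact: (@cvgV C T F FF f l l0 fl). Qed.

Lemma tendsto_sum (I : Type) (r : seq I) (f : I -> T -> C) (a : I -> C) :
  (forall i, tendsto F (f i) (a i)) ->
  tendsto F (fun s => \sum_(i <- r) f i s) (\sum_(i <- r) a i).
Proof.
move=> H; elim: r => [|i r IH].
  rewrite big_nil; under [X in tendsto F X]eq_fun do rewrite big_nil.
  exact: tendsto_cst.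
rewrite big_cons; under [X in tendsto F X]eq_fun do rewrite big_cons.
by apply: tendstoD; [exact: H|exact: IH].
Qed.

Lemma tendsto_horner f l (p : {poly C}) :
  tendsto F f l -> tendsto F (fun s => p.[f s]) p.[l].
Proof.
move=> fl; elim/poly_ind: p => [|p c IH].
  rewrite horner0; under [X in tendsto F X]eq_fun do rewrite horner0.
  exact: tendsto_cst.
rewrite hornerMXaddC.
under [X in tendsto F X]eq_fun do rewrite hornerMXaddC.
by apply: tendstoD; [exact: tendstoM|exact: tendsto_cst].
Qed.

Lemma tendsto_ratio f l (p q : {poly C}) : q.[l] != 0 -> tendsto F f l ->
  tendsto F (fun s => p.[f s] / q.[f s]) (p.[l] / q.[l]).
Proof.
move=> ql fl; apply: tendstoM; first exact: tendsto_horner.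
by apply: tendstoV; [exact: ql|exact: tendsto_horner].
Qed.

Lemma tendsto_eq f g l : F [set s | f s = g s] -> tendsto F f l ->
  tendsto F g l.
Proof.
move=> fg /tendstoP fl; apply/tendstoP => e /fl fle.
by move: (@filterI _ F FF _ _ fg fle); apply: (@filterS _ F FF) => s /= [<-].
Qed.

Lemma tendsto_ext f g l : (forall s, f s = g s) -> tendsto F f l ->
  tendsto F g l.
Proof.
move=> fg; apply: tendsto_eq; move: (@filterT _ F FF).
by apply: (@filterS _ F FF) => s _; exact: fg.
Qed.

Lemma tendsto_near f l (P : set C) : tendsto F f l -> nbhs (l : C^o) P ->
  F [set s | P (f s)].
Proof. by case=> fl /fl. Qed.

Lemma near_Re_gt (b : C) (x : R) : x < complex.Re b ->
  nbhs (b : C^o) [set s | x < complex.Re s].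
Proof.
move=> xb; apply/nbhs_complexP; exists (complex.Re b - x).
  by rewrite subr_gt0.
move=> s /= h; have := le_lt_trans (normc_ge_Re (b - s)) h.
rewrite ltcR raddfB /= ltr_norml => /andP[_]; lra.
Qed.

Lemma tendsto_Re_gt f l (x : R) : tendsto F f l -> x < complex.Re l ->
  F [set s | x < complex.Re (f s)].
Proof. by move=> fl xl; exact: (tendsto_near fl (near_Re_gt xl)). Qed.

Lemma tendsto_neq0 f l : tendsto F f l -> l != 0 -> F [set s | f s != 0].
Proof.
move=> fl l0; apply: (tendsto_near (P := [set s | s != 0]) fl).
apply/nbhs_complexP; exists (complex.Re `|l|).
  have : 0 < `|l| by rewrite normr_gt0.
  by rewrite ltcE => /andP[].
move=> s; rewrite (RRe_real (normr_real l)).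
by apply: contraTneq => ->; rewrite subr0 ltxx.
Qed.

End TendstoFilter.

Lemma tendsto_Re_ge0 (T : Type) (F : set_system T) (PF : ProperFilter F)
    (f : T -> C) l :
  tendsto F f l -> F [set s | 0 <= complex.Re (f s)] -> 0 <= complex.Re l.
Proof.
move=> fl f0; rewrite leNgt; apply/negP => l0.
have /tendsto_Re_gt : tendsto F (fun s => - f s) (- l) by exact: tendstoN.
move=> /(_ 0); rewrite raddfN oppr_gt0 => /(_ l0) fN.
have [s /= [h1]] := filter_ex (filterI f0 fN).
by rewrite raddfN oppr_gt0 ltNge h1.
Qed.

Lemma tendsto_uniq (T : Type) (F : set_system T) (PF : ProperFilter F)
    (f : T -> C) l k : tendsto F f l -> tendsto F f k -> l = k.
Proof.
case=> fl [fk]; exact: (@cvg_unique C^o (@norm_hausdorff C C^o) _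
  (fmap_proper_filter f PF) l k fl fk).
Qed.

(** If [f] eventually avoids each single point, it eventually avoids the finitely many roots of [q].
    This serves both punctured neighbourhoods and infinity. *)
Lemma near_nonroot (T : Type) (F : set_system T) (FF : Filter F) (f : T -> C)
    (q : {poly C}) :
  (forall z, F [set s | f s != z]) -> q != 0 -> F [set s | q.[f s] != 0].
Proof.
move=> Fz q0; have [r qE] := closed_field_poly_normal q.
have : F [set s | f s \notin r].
  elim: r {qE} => [|z r IH]; first exact: filterS (@filterT _ F FF).
  move: (@filterI _ F FF _ _ (Fz z) IH); apply: (@filterS _ F FF) => s /= [].
  by rewrite inE negb_or => -> ->.
apply: (@filterS _ F FF) => s /=.
rewrite -root_prod_XsubC /root {1}qE hornerZ => sr.
by rewrite mulf_neq0 ?lead_coef_eq0.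
Qed.

Lemma near_dnbhs_neq (b z : C) : (b : C^o)^' [set s | s != z].
Proof.
have [->|zb] := eqVneq z b; first exact: (@nbhs_dnbhs_neq C^o b).
apply: (@nbhs_dnbhs C^o b).
apply/nbhs_complexP; exists (complex.Re `|b - z|).
  have : 0 < `|b - z| by rewrite normr_gt0 subr_eq0 eq_sym.
  by rewrite ltcE => /andP[].
move=> s; rewrite (RRe_real (normr_real _)).
by apply: contraTneq => ->; rewrite ltxx.
Qed.

Lemma dnbhs_filter (b : C) : ProperFilter (b : C^o)^'.
Proof. exact: (@Proper_dnbhs_numFieldType C b). Qed.

Lemma tendsto_dnbhs (b : C) : tendsto (b : C^o)^' id b.
Proof. split; exact: (@nbhs_dnbhs C^o b). Qed.

Lemma near_dnbhs_nonroot (b : C) (q : {poly C}) : q != 0 ->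
  (b : C^o)^' [set s | q.[s] != 0].
Proof.
by apply: (@near_nonroot _ _ (dnbhs_filter b) id) => z; exact: near_dnbhs_neq.
Qed.

Lemma near_cinfty_neq (z : C) : cinfty_nbhs R [set s | s != z].
Proof.
exists (complex.Re `|z|) => s; rewrite (RRe_real (normr_real z)).
by apply: contraTneq => ->; rewrite ltxx.
Qed.

Lemma near_cinfty_nonroot (q : {poly C}) : q != 0 ->
  cinfty_nbhs R [set s | q.[s] != 0].
Proof.
by apply: (@near_nonroot _ _ _ id) => z; exact: near_cinfty_neq.
Qed.

Lemma tendsto_cinfty_inv : tendsto (cinfty_nbhs R) (fun s => s^-1) 0.
Proof.
apply/tendstoP => e e0; exists e^-1 => s /=.
have [->|s0] := eqVneq s 0; first by rewrite invr0 subrr normr0 (ltcR 0).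
rewrite sub0r normrN normfV => h.
have ns : 0 < `|s| by rewrite normr_gt0.
have -> : e%:C = (e^-1%:C)^-1 by rewrite (fmorphV (real_complex R)) invrK.
by rewrite ltf_pV2 ?posrE // (ltcR 0) invr_gt0.
Qed.

Lemma Re_jomega (w : R) : complex.Re (jomega w) = 0. Proof. by []. Qed.

Lemma jomega_inj : injective (@jomega R). Proof. by move=> x y []. Qed.

Lemma jomegaB (v w : R) : jomega v - jomega w = jomega (v - w).
Proof. by rewrite /jomega; simpc. Qed.

Lemma norm_jomega (w : R) : `|jomega w| = `|w|%:C.
Proof. by rewrite normc_def /= expr0n add0r sqrtr_sqr. Qed.

Lemma near_jomega_dnbhs (w : R) (P : set C) : (jomega w : C^o)^' P ->
  w^' [set v | P (jomega v)].
Proof.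
move=> /nbhs_complexP[e e0 eP]; apply/nbhs_ballP; exists e => //= v.
rewrite -ball_normE /ball_ /= => wv vw; apply: eP.
  by rewrite jomegaB norm_jomega ltcR.
by rewrite (inj_eq jomega_inj).
Qed.

Lemma tendsto_axis (f : C -> C) (l : C) (w : R) :
  tendsto (jomega w : C^o)^' f l -> tendsto w^' (fun v => f (jomega v)) l.
Proof.
move=> /tendstoP fl; apply/tendstoP => e /fl; exact: near_jomega_dnbhs.
Qed.

Lemma near_axis_nonroot (w : R) (q : {poly C}) : q != 0 ->
  w^' [set v | q.[jomega v] != 0].
Proof. by move=> /(near_dnbhs_nonroot (jomega w)) /near_jomega_dnbhs. Qed.

Lemma near_axis_cinfty (P : set C) : cinfty_nbhs R P ->
  exists M, forall w, M < w -> P (jomega w).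
Proof.
move=> [M MP]; exists `|M| => w wM; apply: MP; rewrite norm_jomega ltcR.
by apply: (le_lt_trans (ler_norm _)); apply: lt_le_trans wM (ler_norm _).
Qed.
End Limits.

(** * A maximum principle for rational functions *)

Section MaxPrinciple.
Variable R : realType.
Notation C := R[i].

Lemma Re_realM (x : R) (z : C) : complex.Re (x%:C * z) = x * complex.Re z.
Proof. by case: z => a b /=; rewrite mul0r subr0. Qed.

Lemma ReB (x y : C) : complex.Re (x - y) = complex.Re x - complex.Re y.
Proof. by case: x y => [a b] []. Qed.

Lemma ReD (x y : C) : complex.Re (x + y) = complex.Re x + complex.Re y.
Proof. by case: x y => [a b] []. Qed.

Lemma ReN (x : C) : complex.Re (- x) = - complex.Re x.
Proof. by case: x. Qed.

(* For f = p / q, the power series of f - f(s0) starts with a term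
   a (s - s0)^k; moving in the direction d with d^k = - 1 / a decreases the
   real part. *)
Lemma local_decrease (p q : {poly C}) (s0 : C) :
  q.[s0] != 0 -> p != (p.[s0] / q.[s0]) *: q ->
  forall e : R, 0 < e -> exists s, [/\ `|s0 - s| < e%:C, q.[s] != 0 &
    complex.Re (p.[s] / q.[s]) < complex.Re (p.[s0] / q.[s0])].
Proof.
move=> qs0; set v := p.[s0] / q.[s0]; rewrite -subr_eq0 => P0 e e0.
have [k [P1 P1s0 PE]] := multiplicity_XsubC (p - v *: q) s0.
have {}P1s0 : P1.[s0] != 0 by rewrite P0 /= in P1s0.
have k0 : (0 < k)%N.
  rewrite lt0n; apply: contraNneq P1s0 => k0.
  by rewrite -[P1]mulr1 -(expr0 ('X - s0%:P)) -k0 -PE !hornerE /v divfK ?subrr.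
pose d : C := k.-root (- (P1.[s0] / q.[s0])^-1).
have dk : d ^+ k = - (P1.[s0] / q.[s0])^-1 by rewrite /d rootCK.
have d0 : 0 < `|d|.
  rewrite normr_gt0; apply: contraTneq (k0) => d0; rewrite -leqNgt leqn0.
  move: dk; rewrite d0 expr0n; case: (k == 0%N) => // /esym/eqP.
  by rewrite oppr_eq0 invr_eq0 mulf_eq0 invr_eq0 (negPf P1s0) (negPf qs0).
(* The cofactor [P1] is kept at [s]: the product is [-1] at [s0], so its real part stays negative
   nearby, and no remainder has to be estimated. *)
have near0 : nbhs (s0 : C^o) [set s | complex.Re (d ^+ k * (P1.[s] / q.[s])) < 0
    /\ q.[s] != 0].
  have t0' : tendsto (nbhs (s0 : C^o)) id s0 by apply/tendstoE; exact: cvg_id.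
  have FF := nbhs_filter (s0 : C^o).
  have h := tendstoZ FF (- d ^+ k) (tendsto_ratio FF P1 qs0 t0').
  have h1 x := @tendsto_Re_gt _ _ _ _ _ x h.
  have h2 := tendsto_neq0 (tendsto_horner FF q t0') qs0.
  have : 0 < complex.Re (- d ^+ k * (P1.[s0] / q.[s0])).
    by rewrite dk opprK mulVf ?mulf_neq0 ?invr_neq0 //= ltr01.
  move=> /h1 h3; move: (@filterI _ _ (nbhs_filter (s0 : C^o)) _ _ h3 h2).
  apply: (@filterS _ _ (nbhs_filter (s0 : C^o))) => s /= [].
  by rewrite mulNr raddfN oppr_gt0.
have [e1 e10 He1] := (nbhs_complexP s0 _).1 near0.
have [t t0 td] : exists2 t : R, 0 < t & t%:C * `|d| < (Num.min e e1)%:C.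
  exists (Num.min e e1 / 2 / complex.Re `|d|).
    by rewrite !divr_gt0 // ?lt_min ?e0 //; move: d0; rewrite ltcE => /andP[].
  rewrite -[X in _ * X](RRe_real (normr_real d)) -rmorphM /= ltcR divfK.
    by rewrite ltr_pdivrMr // ltr_pMr ?ltr1n // lt_min e0.
  by move: d0; rewrite ltcE => /andP[_ /=]; exact: lt0r_neq0.
pose s := s0 + t%:C * d.
have ns : `|s0 - s| = t%:C * `|d|.
  rewrite /s opprD addNKr normrN normrM; congr (_ * _).
  by rewrite normc_def /= expr0n addr0 sqrtr_sqr gtr0_norm.
have nse : `|s0 - s| < e%:C.
  by rewrite ns; apply: (lt_le_trans td); rewrite lecR ge_min lexx.
have nse1 : `|s0 - s| < e1%:C.
  by rewrite ns; apply: (lt_le_trans td); rewrite lecR ge_min lexx orbT.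
exists s; have [h qs] := He1 s nse1; split => //.
have vE : p.[s] / q.[s] - v = (p - v *: q).[s] / q.[s].
  by rewrite hornerD hornerN hornerZ mulrBl mulfK.
have sE : (p - v *: q).[s] / q.[s] = (t ^+ k)%:C * (d ^+ k * (P1.[s] / q.[s])).
  rewrite PE hornerM horner_exp hornerXsubC /s addrAC subrr add0r exprMn.
  by rewrite rmorphXn /=; ring.
by rewrite -subr_lt0 -ReB vE sE Re_realM pmulr_rlt0 // exprn_gt0.
Qed.

(** As long as [k] is positive, [P] is a convergent quotient times a factor tending to 0, so it
    vanishes at [b] and one factor cancels. *)
Lemma dvdp_of_tendsto (b : C) (q2 : {poly C}) : q2.[b] != 0 ->
  forall k (P : {poly C}) (c : C),
  tendsto (b : C^o)^' (fun s => P.[s] / (q2.[s] * (s - b) ^+ k)) c ->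
  exists P3, P = P3 * ('X - b%:P) ^+ k.
Proof.
move=> q2b; have FF := dnbhs_filter b.
have tb := tendsto_dnbhs b.
elim=> [|k IH] P c hP; first by exists P; rewrite expr0 mulr1.
have : root P b.
  apply/eqP; apply: (@tendsto_uniq _ _ _ FF (fun s => P.[s])).
    exact: (@tendsto_horner R _ _ FF _ _ P tb).
  have h : tendsto (b : C^o)^' (fun s => q2.[s] * (s - b) ^+ k.+1) 0.
    have := @tendsto_horner R _ _ FF _ _ (q2 * ('X - b%:P) ^+ k.+1) tb.
    rewrite [X in tendsto _ _ X](_ : _ = 0).
      by apply: tendsto_ext => s; rewrite hornerM horner_exp hornerXsubC.
    by rewrite hornerM horner_exp hornerXsubC subrr expr0n mulr0.
  have := tendstoM FF hP h; rewrite mulr0; apply: tendsto_eq.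
  have q0 : q2 != 0 by apply: contraNneq q2b => ->; rewrite horner0.
  move: (@filterI _ _ FF _ _ (near_dnbhs_nonroot b q0) (near_dnbhs_neq b b)).
  apply: (@filterS _ _ FF) => s /= [qs sb].
  by rewrite divfK // mulf_neq0 // expf_neq0 // subr_eq0.
move=> /factor_theorem[P' PE].
have [|P3 P3E] := IH P' c; last by exists P3; rewrite PE P3E exprSr mulrA.
apply: (tendsto_eq FF _ hP).
move: (near_dnbhs_neq b b); apply: (@filterS _ _ FF) => s /= sb.
rewrite PE hornerM !hornerE exprSr mulrA.
by rewrite -mulf_div divff ?mulr1 // subr_eq0.
Qed.

(** After cancellation, [(s - b) * (p / q)] is regular at [b] with value [c]; subtracting [c] leaves
    a numerator divisible by [s - b]. *)
Lemma simple_pole_decomp (p q : {poly C}) (b c : C) : q != 0 ->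
  tendsto (b : C^o)^' (fun s => (s - b) * (p.[s] / q.[s])) c ->
  exists p1 q1 : {poly C}, q1.[b] != 0 /\
    (b : C^o)^' [set s | p.[s] / q.[s] = c / (s - b) + p1.[s] / q1.[s]].
Proof.
move=> q0 hc; have FF := dnbhs_filter b.
have [k [q2 q2b qE]] := multiplicity_XsubC q b; rewrite q0 /= in q2b.
have q20 : q2 != 0 by apply: contraNneq q2b => ->; rewrite root0.
have [P3 P3E] : exists P3, p * ('X - b%:P) = P3 * ('X - b%:P) ^+ k.
  apply: (dvdp_of_tendsto q2b (c := c)); apply: (tendsto_ext FF _ hc) => s.
  rewrite qE !hornerM horner_exp !hornerXsubC; ring.
have near_ok : (b : C^o)^' [set s | q2.[s] != 0 /\ s - b != 0].
  move: (@filterI _ _ FF _ _ (near_dnbhs_nonroot b q20) (near_dnbhs_neq b b)).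
  by apply: (@filterS _ _ FF) => s /= []; rewrite subr_eq0.
have eqn s : q2.[s] != 0 /\ s - b != 0 ->
    (s - b) * (p.[s] / q.[s]) = P3.[s] / q2.[s].
  move=> [qs sb]; have := congr1 (fun r => r.[s]) P3E.
  rewrite qE !hornerM horner_exp !hornerXsubC => h.
  by rewrite mulrA [_ * p.[s]]mulrC h -mulf_div divff ?mulr1 ?expf_neq0.
have cE : c = P3.[b] / q2.[b].
  apply: (@tendsto_uniq _ _ _ FF _ _ _ hc).
  apply: (tendsto_eq FF _ (tendsto_ratio FF P3 q2b (tendsto_dnbhs b))).
  by move: near_ok; apply: (@filterS _ _ FF) => s /eqn.
have /factor_theorem[p1 p1E] : root (P3 - c *: q2) b.
  by rewrite /root !hornerE cE divfK ?subrr.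
exists p1, q2; split => //.
move: near_ok; apply: (@filterS _ _ FF) => s /= ok; have := eqn s ok.
case: ok => qs sb h; apply: (mulfI sb); rewrite h.
have := congr1 (fun r => r.[s]) p1E; rewrite !hornerE => h2.
apply: (mulIf qs); rewrite mulrDr mulrDl divfK // [_ * (c / _)]mulrC divfK //.
by rewrite [_ * (p1.[s] / _)]mulrCA -mulrA divfK // -h2 addrC subrK.
Qed.

(** With [Re_div_jomega]: an axis pole of residue [c >= 0] adds nothing to the real part on the axis
    and a nonnegative amount to the right of it. *)
Lemma Re_divr_ge0 (c : R) (z : C) : 0 <= c -> 0 <= complex.Re z ->
  0 <= complex.Re (c%:C / z).
Proof.
move=> c0; case: z => a b /= a0; rewrite mul0r subr0 mulr_ge0 //.
by rewrite divr_ge0 // addr_ge0 // sqr_ge0.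
Qed.

Lemma Re_div_jomega (c w : R) : complex.Re (c%:C / jomega w) = 0.
Proof. by rewrite /jomega /=; rewrite mul0r mul0r mulr0 subr0. Qed.

Section Principle.
Variables (p q r : {poly C}) (l : C).
Let f s := p.[s] / q.[s].
Hypothesis q0 : q != 0.
Hypothesis r0 : r != 0.
Hypothesis q_rhp : forall s, 0 < complex.Re s -> q.[s] != 0.
(* The roots of [r] are finitely many points at which nothing is assumed. *)
Hypothesis f_axis : forall w, q.[jomega w] != 0 -> r.[jomega w] != 0 ->
  0 <= complex.Re (f (jomega w)).
(** [p] and [q] may share roots, so a root of [q] can be a removable singularity; then [c = 0]. *)
Hypothesis f_pole : forall w, q.[jomega w] = 0 -> exists2 c : R, 0 <= c &
  tendsto (jomega w : C^o)^' (fun s => (s - jomega w) * f s) c%:C.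
Hypothesis f_inf : tendsto (cinfty_nbhs R) f l.

(** The singular part is harmless to the right of the axis, and the regular part has nonnegative
    real part at [b], as a limit along the axis through points where [f_axis] applies. *)
Let near_boundary (w e : R) : 0 < e -> exists2 d : R, 0 < d &
  forall s, `|jomega w - s| < d%:C -> 0 < complex.Re s ->
    - e < complex.Re (f s).
Proof.
move=> e0; set b := jomega w.
have [c [c0 [p1 [q1 [q1b fE]]]]] : exists c : R, 0 <= c /\
    exists p1 q1 : {poly C}, q1.[b] != 0 /\
    (b : C^o)^' [set s | f s = c%:C / (s - b) + p1.[s] / q1.[s]].
  have [qb|qb] := eqVneq q.[b] 0.
    by have [c c0 /(simple_pole_decomp q0)] := f_pole qb; exists c.
  exists 0; split=> //; exists p, q; split=> //.
  have FF := dnbhs_filter b; move: (@filterT _ _ FF).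
  by apply: (@filterS _ _ FF) => s _ /=; rewrite mul0r add0r.
have g0 : 0 <= complex.Re (p1.[b] / q1.[b]).
  have FF : ProperFilter w^' by exact: Proper_dnbhs_numFieldType.
  apply: (@tendsto_Re_ge0 _ _ _ FF).
    exact: (tendsto_axis (tendsto_ratio (dnbhs_filter b) p1 q1b (tendsto_dnbhs
      b))).
  have h1 := near_axis_nonroot w q0; have h2 := near_axis_nonroot w r0.
  have h3 := near_jomega_dnbhs fE.
  move: (@filterI _ _ FF _ _ h1 (@filterI _ _ FF _ _ h2 h3)).
  apply: (@filterS _ _ FF) => v /= [qv [rv]].
  have := f_axis qv rv => + fv; rewrite fv ReD.
  by rewrite /b jomegaB Re_div_jomega add0r.
have tb : tendsto (nbhs (b : C^o)) id b by apply/tendstoE; exact: cvg_id.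
have FF := nbhs_filter (b : C^o).
have h1 : nbhs (b : C^o) [set s | - e < complex.Re (p1.[s] / q1.[s])].
  apply: (tendsto_Re_gt (tendsto_ratio FF p1 q1b tb)).
  by apply: (lt_le_trans _ g0); rewrite oppr_lt0.
have /nbhs_complexP[d d0 hd] := @filterI _ _ FF _ _ h1 fE.
exists d => // s /hd[/= gs +] s0.
have -> : s != b by apply: contraTneq s0 => ->; rewrite ltxx.
move=> /(_ isT) ->; rewrite ReD; apply: (lt_le_trans gs).
rewrite lerDr Re_divr_ge0 // ReB /= subr0; exact: ltW.
Qed.

Let axis_point (M : R) : exists w, [/\ M < w, q.[jomega w] != 0 &
  r.[jomega w] != 0].
Proof.
have [M1 h1] := near_axis_cinfty (near_cinfty_nonroot q0).
have [M2 h2] := near_axis_cinfty (near_cinfty_nonroot r0).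
exists (Num.max M (Num.max M1 M2) + 1).
have h : Num.max M (Num.max M1 M2) < Num.max M (Num.max M1 M2) + 1.
  by rewrite ltrDl.
move: (h); rewrite {1}gt_max => /andP[hM]; rewrite gt_max => /andP[hM1 hM2].
by split=> //; [exact: h1|exact: h2].
Qed.

(** The value [l] at infinity is also a limit along the axis, so its real part is nonnegative. *)
Let near_infinity (e : R) : 0 < e -> exists M : R,
  forall s, M%:C < `|s| -> - e < complex.Re (f s).
Proof.
move=> e0.
have near (x : R) : x < complex.Re l -> exists M : R,
    forall s, M%:C < `|s| -> x < complex.Re (f s).
  by move=> xl; have [M hM] := tendsto_Re_gt f_inf xl; exists M.
apply: near; apply: (@lt_le_trans _ _ 0); first by rewrite oppr_lt0.
rewrite leNgt; apply/negP => l0.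
have : tendsto (cinfty_nbhs R) (fun s => - f s) (- l) by exact: tendstoN.
move=> /(@tendsto_Re_gt _ _ _ _ _ 0); rewrite ReN oppr_gt0 => /(_ l0)[M hM].
have [w [wM qw rw]] := axis_point `|M|.
have : M%:C < `|jomega w|.
  rewrite norm_jomega ltcR.
  exact: (le_lt_trans (ler_norm _) (lt_le_trans wM (ler_norm _))).
by move=> /hM /=; rewrite ReN oppr_gt0 ltNge f_axis.
Qed.

(* Thanks to the boundary behaviour of [f], [u] is continuous on the whole
   plane and tends to 0 at infinity, so that it attains its minimum if it is
   somewhere negative. *)
Let u s : R := if 0 < complex.Re s then Num.min (complex.Re (f s)) 0 else 0.

Let u_continuous (b : C) (e : R) : 0 < e -> exists2 d : R, 0 < d &
  forall s, `|b - s| < d%:C -> `|u b - u s| < e.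
Proof.
move=> e0; have FF := nbhs_filter (b : C^o).
have tb : tendsto (nbhs (b : C^o)) id b by apply/tendstoE; exact: cvg_id.
have [b0|b0|b0] := ltgtP 0 (complex.Re b).
- have qb := q_rhp b0; have tf := tendsto_ratio FF p qb tb.
  have h1 : nbhs (b : C^o) [set s | complex.Re (f b) - e < complex.Re (f s)].
    by apply: (tendsto_Re_gt tf); rewrite ltrBlDr ltrDl.
  have h2 : nbhs (b : C^o) [set s | complex.Re (- f b) - e < complex.Re (- f
    s)].
    by apply: (tendsto_Re_gt (tendstoN FF tf)); rewrite ltrBlDr ltrDl.
  have h3 := near_Re_gt b0.
  have /nbhs_complexP[d d0 hd] :=
    @filterI _ _ FF _ _ h3 (@filterI _ _ FF _ _ h1 h2).
  exists d => // s /hd[/= s0 [hs]]; rewrite !ReN => hs'.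
  rewrite /u b0 s0 ltr_norml.
  by rewrite !minEle; case: ifP; case: ifP; lra.
- have : nbhs (b : C^o) [set s | complex.Re b < 0 -> complex.Re s < 0].
    have h : tendsto (nbhs (b : C^o)) (fun s => - s) (- b) by exact: tendstoN.
    have h2 := @tendsto_Re_gt _ _ _ _ _ 0 h.
    move: h2; rewrite ReN oppr_gt0 => /(_ b0); apply: (@filterS _ _ FF) => s /=.
    by rewrite ReN oppr_gt0.
  move=> /nbhs_complexP[d d0 hd]; exists d => // s /hd /= /(_ b0) s0.
  have us t : complex.Re t <= 0 -> u t = 0 by rewrite /u leNgt; case: ifP.
  by rewrite !us ?ltW // subrr normr0.
(* On the axis [u] is 0, and nearby it lies between [- e] and 0. *)
- have bE : b = jomega (complex.Im b) by case: b b0 {FF tb} => x y /= <-.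
  have [d d0 hd] := near_boundary (complex.Im b) e0.
  exists d => // s; rewrite bE => /hd hs.
  rewrite /u Re_jomega ltxx; case: ifP => [/hs|_]; last by rewrite subrr normr0.
  by rewrite ltr_norml minEle; case: ifP; lra.
Qed.

Let u_min (M : R) : 0 < M ->
    exists2 s, `|complex.Re s| <= M /\ `|complex.Im s| <= M &
  forall t, `|complex.Re t| <= M -> `|complex.Im t| <= M -> u s <= u t.
Proof.
move=> M0.
pose g (x : R * R) := u (x.1 +i* x.2).
have gc : continuous g.
  move=> [x y]; apply/cvgrPdist_lt => e e0.
  have [d d0 hd] := u_continuous (x +i* y) e0.
  have d2 : 0 < d / 2 by rewrite divr_gt0.
  have h1 : \forall z \near (x, y), `|x - z.1| < d / 2.
    exact: (proj1 (@cvgrPdist_lt _ R _ _ _ _ _) (@cvg_fst _ _ (nbhs x) (nbhs y)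
      _)).
  have h2 : \forall z \near (x, y), `|y - z.2| < d / 2.
    exact: (proj1 (@cvgrPdist_lt _ R _ _ _ _ _) (@cvg_snd _ _ (nbhs x) (nbhs y)
      _)).
  near=> z; apply: hd.
  have -> : x +i* y - (z.1 +i* z.2) = (x - z.1)%:C + 'i * (y - z.2)%:C by simpc.
  apply: (le_lt_trans (ler_normD _ _)).
  have nr (a : R) : `|a%:C| = `|a|%:C.
    by rewrite normc_def /= expr0n addr0 sqrtr_sqr.
  rewrite normrM !nr normc_def /= expr0n add0r expr1n sqrtr1 mul1r -rmorphD
    ltcR /=.
  have : `|x - z.1| < d / 2 by near: z.
  have : `|y - z.2| < d / 2 by near: z.
  by lra.
pose A := (`[- M, M]%classic `*` `[- M, M]%classic : set (R * R)).
have cA : compact A by apply: compact_setX; exact: segment_compact.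
have A0 : A !=set0 by exists (0, 0); split; rewrite /= in_itv /=; lra.
have [[x y] xyA hmin] := @compact_EVT_min _ R g A A0 cA
  (continuous_subspaceT gc).
exists (x +i* y) => /=.
  move: xyA; rewrite inE => -[] /=; rewrite !in_itv /= !ler_norml.
  by move=> /andP[-> ->] /andP[-> ->].
move=> t tx ty; have := hmin (complex.Re t, complex.Im t).
rewrite /g /=; case: t tx ty => a b /=; rewrite !ler_norml => ax bx; apply.
by rewrite inE; split; rewrite /= in_itv.
Unshelve. all: by end_near. Qed.

Lemma maximum_principle s : 0 < complex.Re s ->
  0 <= complex.Re (f s).
Proof.
move=> s0; rewrite leNgt; apply/negP => fs.
have us : u s = complex.Re (f s) by rewrite /u s0 min_l // ltW.
(* With half of the value at [s] as margin, [u] exceeds [u s] outside a large square, so its minimum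
   over the square is global. *)
have e0 : 0 < - complex.Re (f s) / 2 by rewrite divr_gt0 // oppr_gt0.
have [M0 hM0] := near_infinity e0.
pose M := `|M0| + 1.
have M_gt0 : 0 < M by rewrite ltr_pwDr.
have far t : ~ (`|complex.Re t| <= M /\ `|complex.Im t| <= M) ->
    complex.Re (f s) / 2 < u t.
  move=> h; have tM : M0%:C < `|t|.
    have M0M : M0 < M by rewrite /M (le_lt_trans (ler_norm _)) // ltrDl.
    rewrite -(RRe_real (normr_real t)) ltcR ltNge; apply/negP.
    rewrite -lecR (RRe_real (normr_real t)) => tM0; apply: h; split.
      rewrite -lecR; apply: (le_trans (normc_ge_Re t)); apply: (le_trans tM0).
      by rewrite lecR ltW.
    rewrite -lecR; have := normc_ge_Re (- 'i * t).
    have ni : `|- 'i%C| = 1 :> C.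
      by rewrite normrN normc_def /= expr0n add0r expr1n sqrtr1.
    rewrite normrM ni mul1r.
    have -> : complex.Re (- 'i * t) = complex.Im t by case: (t) => x y; simpc.
    move=> h; apply: (le_trans h); apply: (le_trans tM0); by rewrite lecR ltW.
  have := hM0 t tM; rewrite /u; case: ifP => // _ h2; last by lra.
  by rewrite minEle; case: ifP; lra.
have [z [zx zy] zmin] := u_min M_gt0.
have umin t : u z <= u t.
  have [[tx ty]|h] := pselect (`|complex.Re t| <= M /\ `|complex.Im t| <= M).
    exact: zmin.
  have zs : u z <= u s.
    have [[sx sy]|hs] := pselect (`|complex.Re s| <= M /\ `|complex.Im s| <= M).
      exact: zmin.
    by have := far s hs; rewrite us; lra.
  by have := far t h; rewrite us in zs; lra.
have uz : u z < 0 by apply: (le_lt_trans (umin s)); rewrite us.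
have z0 : 0 < complex.Re z.
  by move: uz; rewrite /u; case: ifP => //; rewrite ltxx.
have uzE : u z = complex.Re (f z).
  by move: uz; rewrite /u z0 minEle; case: ifP => //; rewrite ltxx.
(* A constant [f] takes its negative value on the axis as well, against [f_axis]. *)
have [P0|P0] := eqVneq p ((p.[z] / q.[z]) *: q).
  have [w [_ qw rw]] := axis_point 0.
  have := f_axis qw rw; rewrite /f P0 hornerZ mulfK // -/(f z) -uzE.
  by rewrite leNgt uz.
(* The radius [complex.Re z] keeps [t] in the right half plane. *)
have [t [tz qt]] := local_decrease (q_rhp z0) P0 z0.
rewrite -/(f z) -/(f t) -uzE => ft.
have t0 : 0 < complex.Re t.
  have := le_lt_trans (normc_ge_Re (z - t)) tz; rewrite ltcR ReB ltr_norml.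
  by move=> /andP[_]; lra.
have := umin t; rewrite /u t0 leNgt gt_min ft //.
Qed.

(** A nonconstant [f] would take values of negative real part near [s]. This rigidity is the source
    of the strict inequality in [sni_dc_gt0]. *)
Lemma maximum_principle_strict s : 0 < complex.Re s -> complex.Re (f s) <= 0 ->
  p = f s *: q.
Proof.
move=> s0 fs; apply/eqP/contraT => P0.
have [t [tz qt]] := local_decrease (q_rhp s0) P0 s0.
have t0 : 0 < complex.Re t.
  have := le_lt_trans (normc_ge_Re (s - t)) tz; rewrite ltcR ReB ltr_norml.
  by move=> /andP[_]; lra.
rewrite -/(f s) -/(f t) => /lt_le_trans /(_ fs).
by rewrite ltNge maximum_principle.
Qed.
End Principle.
End MaxPrinciple.

(** * Hermitian forms and transfer functions *)

(* Sealed: otherwise failing unifications unfold the matrix products. *)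
HB.lock Definition dotc (R : realType) (n : nat) (x y : 'cV[R[i]]_n) : R[i] :=
  (x ^t* *m y) 0 0.

HB.lock Definition tfun (R : realType) (m n : nat) (A : 'M[R[i]]_n)
    (B : 'M[R[i]]_(n, m)) (K : 'M[R[i]]_(m, n)) (D : 'M[R[i]]_m) (s : R[i]) :
    'M[R[i]]_m :=
  K *m invmx (s%:M - A) *m B + D.

Section Dot.
Variable R : realType.
Notation C := R[i].

Lemma dotc_mx n (x y : 'cV[C]_n) : dotc x y = (x^t* *m y) 0 0.
Proof. by rewrite dotc.unlock. Qed.

Lemma dotcE n (x y : 'cV[C]_n) : dotc x y = \sum_k (x k 0)^*%C * y k 0.
Proof. by rewrite !dotc_mx mxE; apply: eq_bigr => k _; rewrite !mxE. Qed.

Lemma dotcDr n (x y z : 'cV[C]_n) : dotc x (y + z) = dotc x y + dotc x z.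
Proof. by rewrite !dotc_mx mulmxDr mxE. Qed.

Lemma dotcNr n (x y : 'cV[C]_n) : dotc x (- y) = - dotc x y.
Proof. by rewrite !dotc_mx mulmxN mxE. Qed.

Lemma dotcBr n (x y z : 'cV[C]_n) : dotc x (y - z) = dotc x y - dotc x z.
Proof. by rewrite dotcDr dotcNr. Qed.

Lemma dotcZr n a (x y : 'cV[C]_n) : dotc x (a *: y) = a * dotc x y.
Proof. by rewrite !dotc_mx -scalemxAr mxE. Qed.

Lemma dotcC n (x y : 'cV[C]_n) : dotc y x = (dotc x y)^*%C.
Proof.
rewrite !dotcE rmorph_sum; apply: eq_bigr => k _.
by rewrite rmorphM /= conjcK mulrC.
Qed.

Lemma Re_dotcC n (x y : 'cV[C]_n) : complex.Re (dotc y x) =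
    complex.Re (dotc x y).
Proof. by rewrite dotcC; case: (dotc x y). Qed.

Lemma Im_dotcC n (x y : 'cV[C]_n) : complex.Im (dotc y x) =
    - complex.Im (dotc x y).
Proof. by rewrite dotcC; case: (dotc x y). Qed.

Lemma dotcDl n (x y z : 'cV[C]_n) : dotc (x + y) z = dotc x z + dotc y z.
Proof. by rewrite dotcC dotcDr rmorphD /= -!dotcC. Qed.

Lemma dotcNl n (x y : 'cV[C]_n) : dotc (- x) y = - dotc x y.
Proof. by rewrite dotcC dotcNr rmorphN /= -!dotcC. Qed.

Lemma dotcBl n (x y z : 'cV[C]_n) : dotc (x - y) z = dotc x z - dotc y z.
Proof. by rewrite dotcDl dotcNl. Qed.

Lemma dotcZl n a (x y : 'cV[C]_n) : dotc (a *: x) y = a^*%C * dotc x y.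
Proof. by rewrite dotcC dotcZr rmorphM /= -dotcC. Qed.

Lemma dotc0r n (x : 'cV[C]_n) : dotc x 0 = 0.
Proof. by rewrite !dotc_mx mulmx0 mxE. Qed.

Lemma dotc0l n (x : 'cV[C]_n) : dotc 0 x = 0.
Proof. by rewrite dotcC dotc0r conjc0. Qed.

Lemma dotc_gt0 n (x : 'cV[C]_n) : x != 0 -> 0 < complex.Re (dotc x x).
Proof.
move=> x0; have h (k : 'I_n) : 0 <= (x k 0)^*%C * x k 0.
  by rewrite mulrC mulcJ_ge0.
suff: 0 < dotc x x by rewrite ltcE => /andP[].
rewrite dotcE lt_neqAle sumr_ge0 // andbT eq_sym psumr_neq0 //.
have /matrix0Pn[k [j]] := x0; rewrite ord1 => xk; apply/hasP; exists k;
  rewrite ?mem_index_enum //=.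
by rewrite lt_neqAle h andbT eq_sym mulf_neq0 // conjc_eq0.
Qed.

Lemma dotc_mull m n (M : 'M[C]_(m,
    n)) x y : dotc (M *m x) y = dotc x (M ^t* *m y).
Proof. by rewrite !dotc_mx trmx_mul map_mxM mulmxA. Qed.

Lemma ImD (x y : C) : complex.Im (x + y) = complex.Im x + complex.Im y.
Proof. by case: x y => [a b] []. Qed.

Lemma ImN (x : C) : complex.Im (- x) = - complex.Im x.
Proof. by case: x. Qed.

Lemma ImB (x y : C) : complex.Im (x - y) = complex.Im x - complex.Im y.
Proof. by case: x y => [a b] []. Qed.

Lemma Re_jomegaM w (x : C) : complex.Re (jomega w * x) = - (w * complex.Im x).
Proof. by case: x => a b; rewrite /jomega /= mul0r sub0r. Qed.

Lemma Im_jomegaM w (x : C) : complex.Im (jomega w * x) = w * complex.Re x.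
Proof. by case: x => a b; rewrite /jomega /= mul0r add0r. Qed.
End Dot.

(** * Resolvents as ratios of polynomials *)

Section Resolvent.
Variables (R : realType) (n : nat).
Notation C := R[i].
Implicit Types (A : 'M[C]_n) (s t : C).

Lemma resolvent_identity A s t : s%:M - A \in unitmx -> t%:M - A \in unitmx ->
  invmx (s%:M - A) - invmx (t%:M - A) =
  (t - s) *: (invmx (s%:M - A) *m invmx (t%:M - A)).
Proof.
move=> us ut; rewrite scalemxAl.
have -> : (t - s) *: invmx (s%:M - A) =
  invmx (s%:M - A) *m ((t%:M - A) - (s%:M - A)).
  by rewrite opprB addrA subrK -raddfB /= mul_mx_scalar.
by rewrite mulmxBr mulVmx // mulmxBl mul1mx -mulmxA mulmxV // mulmx1.
Qed.

(** Cramer's rule, for a general [P]: it is applied to [X - A] at finite points and to [1 - X A] at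
    infinity. *)
Lemma horner_inv_mx k (P : 'M[{poly C}]_k) (c : 'rV[C]_k) (b : 'cV[C]_k) s :
  (\det P).[s] != 0 ->
  (c *m invmx (map_mx (horner_eval s) P) *m b) 0 0 =
  ((map_mx polyC c *m \adj P *m map_mx polyC b) 0 0).[s] / (\det P).[s].
Proof.
move=> ds; have dE : \det (map_mx (horner_eval s) P) = (\det P).[s].
  by rewrite det_map_mx.
rewrite /invmx unitmxE dE unitfE ds -scalemxAr -scalemxAl mxE mulrC;
  congr (_ / _).
have cE q r (M : 'M[C]_(q, r)) : map_mx (horner_eval s) (map_mx polyC M) = M.
  by apply/matrixP => i j; rewrite !mxE /horner_eval hornerC.
have -> : ((map_mx polyC c *m \adj P *m map_mx polyC b) 0 0).[s] =
    map_mx (horner_eval s) (map_mx polyC c *m \adj P *m map_mx polyC b) 0 0.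
  by rewrite [RHS]mxE.
by rewrite !map_mxM !cE map_mx_adj.
Qed.

Lemma char_poly_mx_eval A s : map_mx (horner_eval s) (char_poly_mx A) =
    s%:M - A.
Proof.
rewrite map_mxB /= map_scalar_mx /= /horner_eval hornerX; congr (_ - _).
by apply/matrixP => i j; rewrite !mxE hornerC.
Qed.

Lemma resolvent_unit A s : (s%:M - A \in unitmx) = ((char_poly A).[s] != 0).
Proof.
by rewrite unitmxE -char_poly_mx_eval det_map_mx unitfE.
Qed.

Definition ss_num A (c : 'rV[C]_n) (b : 'cV[C]_n) : {poly C} :=
  (map_mx polyC c *m \adj (char_poly_mx A) *m map_mx polyC b) 0 0.

Lemma ss_numE A c b s : s%:M - A \in unitmx ->
  (c *m invmx (s%:M - A) *m b) 0 0 = (ss_num A c b).[s] / (char_poly A).[s].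
Proof.
by rewrite resolvent_unit => us; rewrite -char_poly_mx_eval horner_inv_mx.
Qed.

Lemma near_resolvent_unit A s : (s : C^o)^' [set t | t%:M - A \in unitmx].
Proof.
have FF := dnbhs_filter s.
have := near_dnbhs_nonroot s (monic_neq0 (char_poly_monic A)).
by apply: (@filterS _ _ FF) => t /=; rewrite resolvent_unit.
Qed.

Lemma near_cinfty_unit A : cinfty_nbhs R [set t | t%:M - A \in unitmx].
Proof.
have := near_cinfty_nonroot (monic_neq0 (char_poly_monic A)).
by apply: filterS => t /=; rewrite resolvent_unit.
Qed.

(** Since [s - A = s (1 - s^-1 A)], the substitution of [s^-1] moves infinity to 0, where [1 - X A]
    is invertible; the factor [s^-1] left in front tends to 0. *)
Lemma tendsto_resolvent_infty A (c : 'rV[C]_n) (b : 'cV[C]_n) :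
  tendsto (cinfty_nbhs R) (fun s => (c *m invmx (s%:M - A) *m b) 0 0) 0.
Proof.
pose P : 'M[{poly C}]_n := 1%:M - 'X *: map_mx polyC A.
have PE t : map_mx (horner_eval t) P = 1%:M - t *: A.
  rewrite map_mxB /= map_mx1; congr (_ - _).
  by apply/matrixP => i j; rewrite !mxE /horner_eval hornerM hornerX hornerC.
have P0 : (\det P).[0] != 0.
  rewrite -[_.[0]]/(horner_eval 0 _) -det_map_mx PE scale0r subr0 det1.
  exact: oner_neq0.
pose p := (map_mx polyC c *m \adj P *m map_mx polyC b) 0 0.
have FF : Filter (cinfty_nbhs R) by exact: (@filter_filter _ _
  (cinfty_nbhs_filter R)).
have h := tendstoM FF (tendsto_cinfty_inv R)
  (tendsto_ratio FF p P0 (tendsto_cinfty_inv R)).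
rewrite mul0r in h; apply: (tendsto_eq FF _ h).
have := tendsto_neq0 (tendsto_horner FF (\det P) (tendsto_cinfty_inv R)) P0.
move=> h2; move: (@filterI _ _ FF _ _ (near_cinfty_neq (0 : C)) h2).
apply: (@filterS _ _ FF) => s /= [s0 hs]; rewrite -horner_inv_mx // PE.
have -> : s%:M - A = s *: (1%:M - s^-1 *: A).
  by rewrite scalerBr scalerA divff // scale1r scale_scalar_mx mulr1.
rewrite invmxZ; last first.
  by rewrite unitmxZ ?unitfE // -PE unitmxE det_map_mx unitfE.
by rewrite -scalemxAr -scalemxAl [RHS]mxE.
Qed.

Lemma ss_maximum_principle A (c : 'rV[C]_n) (b : 'cV[C]_n) (d : C)
    (r : {poly C}) :
  let f s := (c *m invmx (s%:M - A) *m b) 0 0 + d in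
  r != 0 -> (forall s, 0 < complex.Re s -> s%:M - A \in unitmx) ->
  (forall w, (jomega w)%:M - A \in unitmx -> r.[jomega w] != 0 ->
    0 <= complex.Re (f (jomega w))) ->
  (forall w, (jomega w)%:M - A \notin unitmx -> exists2 c : R, 0 <= c &
    tendsto (jomega w : C^o)^' (fun s => (s - jomega w) * f s) c%:C) ->
  forall s, 0 < complex.Re s -> 0 <= complex.Re (f s) /\
    (complex.Re (f s) <= 0 -> forall t, t%:M - A \in unitmx -> f t = f s).
Proof.
move=> f r0 uA f_axis f_pole s s0.
pose q := char_poly A; pose p := ss_num A c b + d *: q.
have fE t : t%:M - A \in unitmx -> f t = p.[t] / q.[t].
  move=> ut; rewrite /f ss_numE // /p hornerD hornerZ mulrDl mulfK //.
  by rewrite -resolvent_unit.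
have q0 : q != 0 by rewrite monic_neq0 ?char_poly_monic.
have q_rhp t : 0 < complex.Re t -> q.[t] != 0.
  by move=> /uA; rewrite resolvent_unit.
have f_axis' w : q.[jomega w] != 0 -> r.[jomega w] != 0 ->
    0 <= complex.Re (p.[jomega w] / q.[jomega w]).
  by rewrite -resolvent_unit => uw rw; rewrite -fE // f_axis.
have f_pole' w : q.[jomega w] = 0 -> exists2 c : R, 0 <= c &
    tendsto (jomega w : C^o)^' (fun s => (s - jomega w) * (p.[s] / q.[s])) c%:C.
  move=> /eqP qw; have [|k k0 hk] := f_pole w.
    by rewrite resolvent_unit negbK.
  exists k => //; have FF := dnbhs_filter (jomega w);
    apply: (tendsto_eq FF _ hk).
  move: (near_resolvent_unit A (jomega w)); apply: (@filterS _ _ FF) => t /= ut.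
  by rewrite fE.
have f_inf : tendsto (cinfty_nbhs R) (fun s => p.[s] / q.[s]) d.
  have FF : Filter (cinfty_nbhs R) by exact: (@filter_filter _ _
    (cinfty_nbhs_filter R)).
  have h := tendstoD FF (tendsto_resolvent_infty A c b) (tendsto_cst FF d).
  rewrite add0r in h; apply: (tendsto_eq FF _ h).
  by move: (near_cinfty_unit A); apply: (@filterS _ _ FF) => t /= /fE.
rewrite (fE _ (uA s s0)); split.
  exact: (maximum_principle q0 r0 q_rhp f_axis' f_pole' f_inf).
move=> fs t ut; rewrite (fE t ut).
have := maximum_principle_strict q0 r0 q_rhp f_axis' f_pole' f_inf s0 fs.
move=> {1}->; rewrite hornerZ mulfK //.
by rewrite -resolvent_unit.
Qed.
End Resolvent.

(** With [d = t - b0], and [a], [e] the forms of [G t] and [G 0]: the factor [- t ^- 2] turns the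
    residue condition on [t G(t)] into one on [(G(0) - G(t)) / t]. *)
Lemma cancel_square (F : fieldType) (d t a e : F) : t != 0 ->
  (d * t * a - d * t * e) * - t ^- 2 = d * - ((a - e) / t).
Proof. by move=> t0; field. Qed.

Section TransferFunction.
Variables (R : realType) (m n : nat).
Notation C := R[i].

Variables (A : 'M[C]_n) (B : 'M[C]_(n, m)) (K : 'M[C]_(m, n)) (D : 'M[C]_m).
Let G := tfun A B K D.

Lemma tfunE s : tfun A B K D s = K *m invmx (s%:M - A) *m B + D.
Proof. by rewrite tfun.unlock. Qed.

(** At [t = 0] this splits a factor [s] off [G s - G 0] and realizes the quotient. *)
Lemma tfun_resolvent s t : s%:M - A \in unitmx -> t%:M - A \in unitmx ->
  G s - G t = (t - s) *: (K *m invmx (s%:M - A) *m (invmx (t%:M - A) *m B)).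
Proof.
move=> us ut; rewrite /G !tfunE opprD addrACA subrr addr0 -mulmxBl -mulmxBr.
by rewrite resolvent_identity // -scalemxAr -scalemxAl !mulmxA.
Qed.

(** Multiplication by [s] keeps a proper realization: [K] becomes [K A] and the direct term is
    [K B]. *)
Lemma tfun_shift s : s%:M - A \in unitmx ->
  s *: (G s - D) = K *m A *m invmx (s%:M - A) *m B + K *m B.
Proof.
move=> us; rewrite /G !tfunE addrK scalemxAl scalemxAr -mulmxDl; congr (_ *m _).
rewrite -mulmxA; rewrite -[X in _ = _ + X]mulmx1 -mulmxDr; congr (_ *m _).
have <- : (s%:M - A) *m invmx (s%:M - A) = 1%:M by rewrite mulmxV.
by rewrite -mulmxDl subrKC mul_scalar_mx.
Qed.

Lemma ni_positive_real (y : 'cV[C]_m) (r : {poly C}) : r != 0 ->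
  (forall s, 0 <= complex.Re s -> s%:M - A \in unitmx) ->
  complex.Im (dotc y (D *m y)) = 0 ->
  (forall w, w != 0 -> r.[jomega w] != 0 ->
    w * complex.Im (dotc y (G (jomega w) *m y)) <= 0) ->
  forall s, 0 < complex.Re s -> 0 <= complex.Re (s * dotc y ((G s - D) *m y)).
Proof.
move=> r0 uA Dy Gy s s0.
have fE t : t%:M - A \in unitmx -> t * dotc y ((G t - D) *m y) =
    (y^t* *m K *m A *m invmx (t%:M - A) *m (B *m y)) 0 0 + dotc y (K *m B *m y).
  move=> ut; rewrite -dotcZr scalemxAl tfun_shift // mulmxDl dotcDr.
  by rewrite !dotc_mx !mulmxA.
rewrite (fE _ (uA _ (ltW s0))).
apply: (ss_maximum_principle r0 _ _ _ s0).1.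
- by move=> t /ltW /uA.
- move=> w uw rw; rewrite -fE // Re_jomegaM oppr_ge0.
  have [->|w0] := eqVneq w 0; first by rewrite mul0r.
  by rewrite mulmxBl dotcBr ImB Dy subr0 Gy.
- by move=> w; rewrite uA // Re_jomega.
Qed.

(** In the case of equality [(G(0) - G(s)) / s] has a constant form with real part 0, and this
    propagates to the axis. *)
Lemma ni_positive_real_inv (y : 'cV[C]_m) (r : {poly C}) : r != 0 ->
  (forall s, 0 < complex.Re s -> s%:M - A \in unitmx) ->
  0%:M - A \in unitmx -> complex.Im (dotc y (G 0 *m y)) = 0 ->
  (forall w, w != 0 -> (jomega w)%:M - A \in unitmx -> r.[jomega w] != 0 ->
    w * complex.Im (dotc y (G (jomega w) *m y)) <= 0) ->
  (forall w, w != 0 -> (jomega w)%:M - A \notin unitmx ->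
    exists2 c : R, 0 <= c &
    tendsto (jomega w : C^o)^'
      (fun s => (s - jomega w) * s * dotc y (G s *m y)) c%:C) ->
  forall s, 0 < complex.Re s ->
    complex.Re (dotc y ((G s - G 0) *m y) / s) <= 0 /\
   (0 <= complex.Re (dotc y ((G s - G 0) *m y) / s) -> forall w, w != 0 ->
      (jomega w)%:M - A \in unitmx ->
      complex.Im (dotc y (G (jomega w) *m y)) = 0).
Proof.
move=> r0 uA u0 G0y Gy Gpole s s0.
pose c := y^t* *m K; pose b := invmx (0%:M - A) *m B *m y.
pose f t : C := (c *m invmx (t%:M - A) *m b) 0 0 + 0.
have fE t : t%:M - A \in unitmx -> dotc y ((G t - G 0) *m y) = - (t * f t).
  move=> ut; rewrite tfun_resolvent // sub0r scaleNr mulNmx dotcNr -scalemxAl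
    dotcZr.
  by rewrite /f addr0 /c /b !dotc_mx !mulmxA.
have fE' t : t != 0 -> t%:M - A \in unitmx ->
  f t = - (dotc y ((G t - G 0) *m y) / t).
  by move=> t0 ut; rewrite fE // mulNr opprK mulrC mulKf.
have jw0 w : w != 0 -> jomega w != 0 :> C by apply: contraNneq => -[->].
have Re_f w : w != 0 -> (jomega w)%:M - A \in unitmx ->
    complex.Re (f (jomega w)) = - (complex.Im (dotc y (G (jomega w) *m y)) / w).
  move=> w0 uw.
  have /eqP := fE _ uw; rewrite mulmxBl dotcBr subr_eq => /eqP ->.
  by rewrite ImD G0y addr0 ImN Im_jomegaM; field.
(* The factor ['X] excludes [w = 0], where [Re_f] says nothing. *)
have r'0 : r * 'X != 0 by rewrite mulf_neq0 // polyX_eq0.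
have [f0 fc] : 0 <= complex.Re (f s) /\
    (complex.Re (f s) <= 0 -> forall t, t%:M - A \in unitmx -> f t = f s).
  apply: (ss_maximum_principle r'0) => //.
    move=> w uw; rewrite hornerM hornerX mulf_eq0 negb_or => /andP[rw jw].
    have w0 : w != 0 by apply: contraNneq jw => ->.
    rewrite Re_f // oppr_ge0 -(pmulr_rle0 _ (_ : 0 < w ^+ 2)); last first.
      by rewrite lt_neqAle sqr_ge0 andbT eq_sym sqrf_eq0.
    by rewrite expr2 mulrACA divff // mulr1 Gy.
  move=> w uw; have w0 : w != 0 by apply: contraNneq uw => ->.
  have [k k0 hk] := Gpole w w0 uw.
  (* The residue is divided by [- (jomega w) ^+ 2], which is [w ^+ 2]. *)
  exists (k / w ^+ 2); first by rewrite divr_ge0 // sqr_ge0.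
  set b0 := jomega w in uw hk *.
  have FF := dnbhs_filter b0; have tb := tendsto_dnbhs b0.
  have t2 : tendsto (b0 : C^o)^' (fun s => - (s ^- 2)) (- (b0 ^- 2)).
    apply: tendstoN; apply: tendstoV; first by rewrite expf_neq0 // jw0.
    by rewrite !expr2; exact: tendstoM.
  have t3 : tendsto (b0 : C^o)^' (fun s => (s - b0) * s * dotc y (G 0 *m y)) 0.
    have := tendstoM FF (tendstoM FF (tendstoB FF tb (tendsto_cst FF b0)) tb)
      (tendsto_cst FF (dotc y (G 0 *m y))).
    by rewrite subrr !mul0r.
  have := tendstoM FF (tendstoB FF hk t3) t2; rewrite subr0.
  rewrite [X in tendsto _ _ X](_ : _ = (k / w ^+ 2)%:C).
    apply: tendsto_eq.
    move: (@filterI _ _ FF _ _ (near_resolvent_unit A b0) (near_dnbhs_neq b0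
      0)).
    apply: (@filterS _ _ FF) => t /= [ut t0];
      rewrite -/(f t) fE' // mulmxBl dotcBr.
    exact: cancel_square.
  have -> : b0 ^- 2 = - (w ^- 2)%:C.
    rewrite (_ : b0 = 'i%C * w%:C); last by rewrite /b0 /jomega; simpc.
    by rewrite exprMn sqr_i mulN1r invrN -rmorphXn -fmorphV.
  by rewrite opprK -rmorphM.
have s_neq0 : s != 0 by apply: contraTneq s0 => ->; rewrite ltxx.
have -> : dotc y ((G s - G 0) *m y) / s = - f s.
  by rewrite fE' ?opprK // uA.
rewrite ReN oppr_le0 oppr_ge0; split; first exact: f0.
move=> fs0 w w0 uw.
have fs : complex.Re (f s) = 0 by apply/eqP; rewrite eq_le fs0 f0.
have /eqP := Re_f w w0 uw; rewrite (fc fs0 _ uw) fs eq_sym oppr_eq0.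
by rewrite mulf_eq0 invr_eq0 (negPf w0) orbF => /eqP.
Qed.
End TransferFunction.

(** * Minimal realizations *)

Section Minimality.
Variable F : fieldType.

(** The spaces increase with [N] and have rank at most [n], so two successive ones coincide; [A]
    maps each into the next. *)
Lemma krylov_stable m n (A : 'M[F]_n) (K : 'M[F]_(m, n)) :
  exists N, let V := (\sum_(k < N.+1) <<K *m A ^+ k>>)%MS in (V *m A <= V)%MS.
Proof.
pose V N := (\sum_(k < N.+1) <<K *m A ^+ k>>)%MS.
have VS N : (V N <= V N.+1)%MS.
  by rewrite /V [X in (_ <= X)%MS]big_ord_recr /= addsmxSl.
have [N hN] : exists N, \rank (V N.+1) = \rank (V N).
  apply/not_existsP => h.
  have hr N : (N <= \rank (V N))%N.
    elim: N => // N IH; apply: (leq_ltn_trans IH).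
    by rewrite ltn_neqAle mxrankS // andbT eq_sym; apply/eqP/h.
  by have := leq_trans (hr n.+1) (rank_leq_col _); rewrite ltnn.
exists N; rewrite -/(V N).
have eqV : (V N.+1 <= V N)%MS by have := mxrank_leqif_sup (VS N) => -[_ <-];
  rewrite hN.
apply: (submx_trans _ eqV).
rewrite sumsmxMr; apply/sumsmx_subP => k _.
rewrite (eqmxMr A (genmxE _)) -mulmxA -[A ^+ k *m A]/(A ^+ k * A) -exprSr.
have kN : (k.+1 < N.+2)%N by rewrite ltnS.
by apply: (sumsmx_sup (Ordinal kN)) => //=; rewrite genmxE.
Qed.
End Minimality.

Section StateSpaces.
Variables (R : realType) (m : nat).

Lemma unit_char_poly_mx n (A : 'M[R]_n) :
  map_mx (@tofrac {poly R}) (char_poly_mx A) \in unitmx.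
Proof.
rewrite unitmxE det_map_mx unitfE tofrac_eq0.
exact/monic_neq0/char_poly_monic.
Qed.

Lemma map_ratCM p q r (X : 'M[R]_(p, q)) (Y : 'M[R]_(q, r)) :
  map_mx (@ratC R) (X *m Y) = map_mx (@ratC R) X *m map_mx (@ratC R) Y.
Proof. exact: (@map_mxM _ _ ((@tofrac {poly R}) \o polyC)). Qed.

(** The rows of all [C A^k] span an invariant space containing those of [C]; restricting the system
    to it preserves the transfer function. By minimality it is the whole space, and the [X k] form a
    left inverse of the observability matrix. *)
Lemma minimal_observable n (S : state_space R m n) G :
  minimal_realization S G ->
  exists N (X : 'I_N -> 'M[R]_(n, m)),
    1%:M = \sum_(k < N) X k *m (ssC S *m ssA S ^+ k).
Proof.
move=> [SG Smin]; have [N] := krylov_stable (ssA S) (ssC S).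
set V := (\sum_(k < _) _)%MS => /= VA.
have CV : (ssC S <= V)%MS.
  apply: (sumsmx_sup (ord0 : 'I_N.+1)) => //.
  by rewrite genmxE expr0 mulmx1.
move: (row_base V) (eq_row_base V) => T TV.
have /submxP[A' A'E] : (T *m ssA S <= T)%MS.
  by rewrite (eqmxMr (ssA S) TV) TV.
have /submxP[C' C'E] : (ssC S <= T)%MS by rewrite TV.
pose S' := StateSpace A' (T *m ssB S) C' (ssD S).
have S'G : ss_transfer S' = G.
  rewrite -SG /ss_transfer /=; congr (_ + _).
  rewrite map_ratCM !mulmxA; congr (_ *m _).
  rewrite [in RHS]C'E map_ratCM -!mulmxA; congr (_ *m _).
  apply: (canLR (mulKmx (unit_char_poly_mx A'))).
  rewrite mulmxA; apply: (canRL (mulmxK (unit_char_poly_mx (ssA S)))).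
  have TE : map_mx (@ratC R) T = map_mx (@tofrac {poly R}) (map_mx polyC T).
    by rewrite -map_mx_comp.
  rewrite TE -!map_mxM; congr (map_mx _ _).
  rewrite /char_poly_mx mulmxBr mulmxBl -!map_mxM A'E; congr (_ - _).
  by rewrite scalar_mxC.
have := Smin _ _ S'G; rewrite leq_eqVlt ltnNge rank_leq_col orbF => /eqP nV.
have : (1%:M <= V)%MS by rewrite sub1mx /row_full -nV.
move=> /sub_sumsmxP[u uE]; rewrite uE.
have h (k : 'I_N.+1) : exists v, u k *m <<ssC S *m ssA S ^+ k>>%MS =
    v *m (ssC S *m ssA S ^+ k).
  by apply/submxP; rewrite (submx_trans (submxMl _ _)) ?genmxE.
have [X XE] := choice h.
by exists N.+1, X; apply: eq_bigr => k _.
Qed.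

Lemma trmx_exp n (A : 'M[R]_n) k : (A ^+ k)^T = A^T ^+ k.
Proof.
elim: k => [|k IH]; first by rewrite !expr0 trmx1.
by rewrite exprS exprSr -IH; exact: trmx_mul.
Qed.

Definition ss_dual n (S : state_space R m n) : state_space R m n :=
  StateSpace (ssA S)^T (ssC S)^T (ssB S)^T (ssD S)^T.

Lemma ss_transfer_dual n (S : state_space R m n) :
  ss_transfer (ss_dual S) = (ss_transfer S)^T.
Proof.
rewrite /ss_transfer /ss_dual /= linearD /= map_trmx; congr (_ + _).
rewrite !trmx_mul trmx_inv -mulmxA; congr (_ *m (invmx _ *m _)).
- by rewrite map_trmx.
- by rewrite map_trmx /char_poly_mx linearB /= tr_scalar_mx map_trmx.
- by rewrite map_trmx.
Qed.

Lemma minimal_dual n (S : state_space R m n) G :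
  minimal_realization S G -> minimal_realization (ss_dual S) G^T.
Proof.
move=> [SG Smin]; split; first by rewrite ss_transfer_dual SG.
move=> n' S' S'G; apply: (Smin _ (ss_dual S')).
by rewrite ss_transfer_dual S'G trmxK.
Qed.

Lemma minimal_controllable n (S : state_space R m n) G :
  minimal_realization S G ->
  exists N (X : 'I_N -> 'M[R]_(m, n)),
    1%:M = \sum_(k < N) ssA S ^+ k *m ssB S *m X k.
Proof.
move=> /minimal_dual /minimal_observable [N [X /= XE]].
exists N, (fun k : 'I_N => (X k)^T); rewrite -[LHS]trmx1 XE linear_sum /=.
by apply: eq_bigr => k _; rewrite !trmx_mul trmx_exp !trmxK.
Qed.
End StateSpaces.

(** * Limits of matrices and evaluation of transfer matrices *)

Section MatrixLimits.
Variable R : realType.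
Notation C := R[i].

Definition mtendsto m n (F : set_system C) (f : C ->
  'M[C]_(m, n)) (L : 'M[C]_(m, n)) :=
  forall i j, tendsto F (fun s => f s i j) (L i j).

Section Filter.
Variables (F : set_system C).
Hypothesis FF : Filter F.

Lemma mtendsto_cst m n (L : 'M[C]_(m, n)) : mtendsto F (fun=> L) L.
Proof. by move=> i j; exact: tendsto_cst. Qed.

Lemma mtendstoD m n (f g : C -> 'M[C]_(m, n)) L M :
  mtendsto F f L -> mtendsto F g M -> mtendsto F (fun s => f s + g s) (L + M).
Proof.
move=> fL gM i j; rewrite mxE; have := tendstoD FF (fL i j) (gM i j).
by apply: tendsto_ext => s; rewrite mxE.
Qed.

Lemma mtendstoZ m n (c : C -> C) (f : C -> 'M[C]_(m, n)) l L :
  tendsto F c l -> mtendsto F f L -> mtendsto F (fun s => c s *: f s) (l *: L).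
Proof.
move=> cl fL i j; rewrite mxE; have := tendstoM FF cl (fL i j).
by apply: tendsto_ext => s; rewrite mxE.
Qed.

Lemma mtendstoM m n p (f : C -> 'M[C]_(m, n)) (g : C -> 'M[C]_(n, p)) L M :
  mtendsto F f L -> mtendsto F g M -> mtendsto F (fun s => f s *m g s) (L *m M).
Proof.
move=> fL gM i j; rewrite mxE.
have := tendsto_sum FF (index_enum 'I_n)
  (fun k => tendstoM FF (fL i k) (gM k j)).
by apply: tendsto_ext => s; rewrite mxE.
Qed.

Lemma mtendsto_sum m n (I : finType) (f : I -> C -> 'M[C]_(m, n)) L :
  (forall i, mtendsto F (f i) (L i)) ->
  mtendsto F (fun s => \sum_i f i s) (\sum_i L i).
Proof.
move=> fL i j; rewrite summxE.
have := tendsto_sum FF (index_enum I) (fun k => fL k i j).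
by apply: tendsto_ext => s; rewrite summxE.
Qed.

Lemma mtendsto_eq m n (f g : C -> 'M[C]_(m, n)) L :
  F [set s | f s = g s] -> mtendsto F f L -> mtendsto F g L.
Proof.
move=> fg fL i j; apply: (tendsto_eq FF _ (fL i j)).
by move: fg; apply: (@filterS _ _ FF) => s /= ->.
Qed.

Lemma mtendsto_dotc n (y : 'cV[C]_n) f L : mtendsto F f L ->
  tendsto F (fun s => dotc y (f s)) (dotc y L).
Proof.
move=> fL; rewrite dotc_mx; have := mtendstoM (mtendsto_cst (y^t* )) fL 0 0.
by apply: (tendsto_ext FF) => s; rewrite dotc_mx.
Qed.
End Filter.

Lemma mtendsto_uniq m n (F : set_system C) (PF : ProperFilter F)
    (f : C -> 'M[C]_(m, n)) L M :
  mtendsto F f L -> mtendsto F f M -> L = M.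
Proof. by move=> fL fM; apply/matrixP => i j;
  exact: tendsto_uniq (fL i j) (fM i j). Qed.

(* Controllability spreads the residue of the transfer function to the whole
   state space. *)
Lemma residue_state m n N (A : 'M[C]_n) (B : 'M[C]_(n, m)) (K : 'M[C]_(m, n))
    (X : 'I_N -> 'M[C]_(m, n)) (s : C) (L : 'M[C]_m) :
  1%:M = \sum_(k < N) A ^+ k *m B *m X k ->
  mtendsto (s : C^o)^' (fun t => (t - s) *: (K *m invmx (t%:M - A) *m B)) L ->
  forall x : 'cV[C]_n, exists w,
    mtendsto (s : C^o)^' (fun t =>
      (t - s) *: (K *m invmx (t%:M - A) *m x)) (L *m w).
Proof.
move=> X1 hL x; have FF := dnbhs_filter s; have ts := tendsto_dnbhs s.
(* Replacing one [A] by [t] costs a factor [t%:M - A], which cancels the inverse and leaves a term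
   killed by [t - s]. *)
have hk k : mtendsto (s : C^o)^'
    (fun t => (t - s) *: (K *m invmx (t%:M - A) *m (A ^+ k *m B))) (s ^+ k *:
      L).
  elim: k => [|k IH]; first by rewrite !expr0 scale1r mul1mx.
  have h0 := tendstoB FF ts (tendsto_cst FF s).
  have := mtendstoD FF (mtendstoZ FF ts IH)
    (mtendstoZ FF h0 (mtendsto_cst FF (- (K *m (A ^+ k *m B))))).
  rewrite subrr scale0r addr0 scalerA -exprS; apply: (mtendsto_eq FF).
  move: (near_resolvent_unit A s); apply: (@filterS _ _ FF) => t /= ut.
  rewrite scalerA mulrC -scalerA -scalerDr; congr (_ *: _).
  rewrite exprS -[A * _]/(A *m A ^+ k) -[A *m _ *m B]mulmxA.
  set Y := A ^+ k *m B.
  have -> : A *m Y = t *: Y - (t%:M - A) *m Y.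
    by rewrite mulmxBl mul_scalar_mx subKr.
  by rewrite mulmxBr -scalemxAr -[K *m _ *m (_ *m Y)]mulmxA mulKmx.
exists (\sum_(k < N) s ^+ k *: (X k *m x)).
have hs (k : 'I_N) := mtendstoM FF (hk k) (mtendsto_cst FF (X k *m x)).
have := mtendsto_sum FF hs.
have -> : \sum_(k < N) s ^+ k *: L *m (X k *m x) =
    L *m \sum_(k < N) s ^+ k *: (X k *m x).
  by rewrite mulmx_sumr; apply: eq_bigr => k _; rewrite -scalemxAl scalemxAr.
apply: (mtendsto_eq FF); move: (@filterT _ _ FF).
apply: (@filterS _ _ FF) => t _ /=.
rewrite -[X in _ = _ *: (_ *m X)]mul1mx X1 mulmx_suml mulmx_sumr scaler_sumr.
by apply: eq_bigr => k _; rewrite -scalemxAl !mulmxA.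
Qed.

End MatrixLimits.

Section Evaluation.
Variable R : realType.
Notation C := R[i].
Notation cmx := (map_mx (real_complex R)).

(** By coprimality the reduced denominator divides [q], so any fraction with [q.[s] != 0] can be
    used for evaluation. *)
Lemma reval_ratio (f : {fraction {poly R}}) (p q : {poly R}) (s : C) :
  f = tofrac p / tofrac q -> (polyRC q).[s] != 0 ->
  (polyRC (rden f)).[s] != 0 /\
  reval f s = (polyRC p).[s] / (polyRC q).[s].
Proof.
move=> fE qs; have q0 : q != 0.
  by apply: contraNneq qs => ->; rewrite /polyRC rmorph0 horner0.
have E : rnum f * q = p * rden f.
  apply/eqP; rewrite -tofrac_eq !tofracM -eqr_div ?tofrac_eq0 ?rden_neq0 //.
  by rewrite -rnum_rden fE.
have /dvdpP[k qE] : rden f %| q.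
  rewrite -(@Gauss_dvdpr _ q (rnum f)); first by rewrite E dvdp_mull.
  by rewrite coprimep_sym coprime_rnum_rden.
have ds : (polyRC (rden f)).[s] != 0.
  apply: contraNneq qs => ds.
  by rewrite qE /polyRC rmorphM /= hornerM -/(polyRC _) -/(polyRC _) ds mulr0.
split=> //; rewrite /reval; apply/eqP; rewrite eqr_div //.
have := congr1 (fun h => (polyRC h).[s]) E.
by rewrite /polyRC !rmorphM !hornerM => /eqP.
Qed.

Lemma pole_order_gt0 (f : {fraction {poly R}}) (s : C) :
  (0 < pole_order f s)%N = ((polyRC (rden f)).[s] == 0).
Proof.
have d0 : polyRC (rden f) != 0 by rewrite map_poly_eq0 rden_neq0.
by rewrite /pole_order -XsubC_dvd // dvdp_XsubCl.
Qed.

Lemma tf_poleP m (G : tfmatrix R m) (s : C) :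
  ~ tf_pole G s <-> forall k l, (polyRC (rden (G k l))).[s] != 0.
Proof.
split=> [h k l|h [k [l]]]; last by rewrite pole_order_gt0 (negPf (h k l)).
by apply/negP => ds; apply: h; exists k, l; rewrite pole_order_gt0.
Qed.

Definition ss_eval m n (S : state_space R m n) : C -> 'M[C]_m :=
  tfun (cmx (ssA S)) (cmx (ssB S)) (cmx (ssC S)) (cmx (ssD S)).

(** Named so as to carry a ring morphism structure, through which [map_mx] commutes with
    determinants and adjugates. *)
Definition evalRC (s : C) (p : {poly R}) : C := (polyRC p).[s].
HB.instance Definition _ s :=
  GRing.RMorphism.copy (evalRC s) (horner_eval s \o map_poly (real_complex R)).

Lemma ss_transferE m n (S : state_space R m n) (P : 'M[{poly R}]_m) :
  P = map_mx polyC (ssC S) *m \adj (char_poly_mx (ssA S)) *m map_mx polyC (ssB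
    S)
      + char_poly (ssA S) *: map_mx polyC (ssD S) ->
  forall k l, ss_transfer S k l = tofrac (P k l) / tofrac (char_poly (ssA S)).
Proof.
move=> PE k l; set q := char_poly (ssA S).
have q0 : tofrac q != 0 by rewrite tofrac_eq0 monic_neq0 // char_poly_monic.
suff -> : ss_transfer S = (tofrac q)^-1 *: map_mx (@tofrac {poly R}) P.
  by rewrite !mxE mulrC.
have rE p r (X : 'M[R]_(p, r)) :
    map_mx (@ratC R) X = map_mx (@tofrac {poly R}) (map_mx polyC X).
  by rewrite -map_mx_comp.
rewrite /ss_transfer !rE /invmx unitmxE det_map_mx -/(char_poly _) -/q unitfE
  q0.
have -> : map_mx (@tofrac {poly R}) P =
    map_mx (@tofrac {poly R}) (map_mx polyC (ssC S)) *m \adj (map_mx (@tofrac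
      {poly R}) (char_poly_mx (ssA S)))
      *m map_mx (@tofrac {poly R}) (map_mx polyC (ssB S))
    + tofrac q *: map_mx (@tofrac {poly R}) (map_mx polyC (ssD S)).
  by rewrite PE map_mxD !map_mxM map_mxZ map_mx_adj.
by rewrite scalerDr scalerA mulVf // scale1r -scalemxAr -scalemxAl.
Qed.

Lemma evalRC_polyC p r (X : 'M[R]_(p,
    r)) s : map_mx (evalRC s) (map_mx polyC X) = cmx X.
Proof.
rewrite -map_mx_comp; apply/matrixP => i j.
by rewrite !mxE /= /evalRC /polyRC map_polyC /= hornerC.
Qed.

Lemma evalRC_char_poly_mx n (A : 'M[R]_n) s :
  map_mx (evalRC s) (char_poly_mx A) = s%:M - cmx A.
Proof.
rewrite map_mxB evalRC_polyC map_scalar_mx; congr (_%:M - _).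
by rewrite /= /evalRC /polyRC map_polyX hornerX.
Qed.

Lemma evalRC_char_poly n (A : 'M[R]_n) s :
  (polyRC (char_poly A)).[s] = \det (s%:M - cmx A).
Proof. by rewrite -evalRC_char_poly_mx det_map_mx. Qed.

Lemma ss_evalE m n (S : state_space R m n) s :
  s%:M - cmx (ssA S) \in unitmx ->
  ~ tf_pole (ss_transfer S) s /\ tf_eval (ss_transfer S) s = ss_eval S s.
Proof.
rewrite unitmxE unitfE -evalRC_char_poly => qs.
have SE := ss_transferE (erefl _) (S := S).
set P := _ + _ in SE.
split.
  by apply/tf_poleP => k l; case: (reval_ratio (SE k l) qs).
have -> : tf_eval (ss_transfer S) s =
    (evalRC s (char_poly (ssA S)))^-1 *: map_mx (evalRC s) P.
  apply/matrixP => k l; rewrite [LHS]mxE [RHS]mxE [X in _ = _ * X]mxE.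
  by case: (reval_ratio (SE k l) qs) => _ ->; rewrite mulrC.
rewrite /ss_eval !tfunE /P map_mxD !map_mxM map_mxZ !evalRC_polyC map_mx_adj.
rewrite evalRC_char_poly_mx scalerDr scalerA mulVf // scale1r; congr (_ + _).
rewrite /invmx unitmxE unitfE -evalRC_char_poly qs.
by rewrite -scalemxAr -scalemxAl.
Qed.

Lemma tf_infinityE m n (S : state_space R m n) :
  tf_infty (ss_transfer S) = cmx (ssD S).
Proof.
apply/matrixP => k l; rewrite mxE.
have FF := cinfty_nbhs_filter R.
have h := tendstoD FF (tendsto_resolvent_infty (cmx (ssA S))
  (row k (cmx (ssC S))) (col l (cmx (ssB S)))) (tendsto_cst FF (cmx (ssD S) k
    l)).
rewrite add0r in h.
have /tendstoE : tendsto (cinfty_nbhs R) (reval (ss_transfer S k l)) (cmx (ssD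
  S) k l).
  apply: (tendsto_eq FF _ h).
  move: (near_cinfty_unit (cmx (ssA S))); apply: (@filterS _ _ FF) => s /= us.
  have [_ /matrixP/(_ k l)] := ss_evalE us; rewrite [LHS]mxE => ->.
  rewrite /ss_eval !tfunE [RHS]mxE; congr (_ + _).
  by rewrite -row_mul colE mulmxA -colE -row_mul [LHS]mxE [LHS]mxE.
move=> hl; apply: (@cvg_lim C^o) => //; exact: (@norm_hausdorff C C^o).
Qed.

Lemma mtendsto_tf_eval m (G : tfmatrix R m) (s : C) : ~ tf_pole G s ->
  mtendsto (s : C^o)^' (tf_eval G) (tf_eval G s).
Proof.
move=> /tf_poleP h k l; have FF := dnbhs_filter s; rewrite mxE.
have := tendsto_ratio FF (polyRC (rnum (G k l))) (h k l) (tendsto_dnbhs s).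
by apply: tendsto_ext => t; rewrite mxE.
Qed.
End Evaluation.

(** * Poles, conjugation and the negative imaginary conditions *)

Section Kernel.
Variable R : realType.
Notation C := R[i].
Notation cmx := (map_mx (real_complex R)).

Lemma nonunit_kernel n (M : 'M[C]_n) : M \notin unitmx ->
  exists2 x : 'cV[C]_n, x != 0 & M *m x = 0.
Proof.
rewrite unitmxE unitfE negbK -det_tr => /det0P[v v0 vM].
exists v^T; first by rewrite trmx_eq0.
by apply: trmx_inj; rewrite trmx_mul trmxK vM trmx0.
Qed.

Lemma unit_kernel n (M : 'M[C]_n) (x : 'cV[C]_n) : M \in unitmx ->
  M *m x = 0 -> x = 0.
Proof. by move=> uM /(congr1 (mulmx (invmx M))); rewrite mulKmx // mulmx0. Qed.

(** On an eigenvector [K A^k x = s^k K x], so all terms of the observability sum vanish. *)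
Lemma observable_eigenvector m n N (A : 'M[C]_n) (K : 'M[C]_(m, n))
    (X : 'I_N -> 'M[C]_(n, m)) s (x : 'cV[C]_n) :
  1%:M = \sum_(k < N) X k *m (K *m A ^+ k) ->
  (s%:M - A) *m x = 0 -> K *m x = 0 -> x = 0.
Proof.
move=> X1 /eqP; rewrite mulmxBl subr_eq0 mul_scalar_mx => /eqP Ax Kx.
have Akx k : A ^+ k *m x = s ^+ k *: x.
  elim: k => [|k IH]; first by rewrite !expr0 mul1mx scale1r.
  by rewrite exprSr -[_ * A]/(A ^+ k *m A) -mulmxA -Ax -scalemxAr IH scalerA
    -exprS.
rewrite -[x]mul1mx X1 mulmx_suml big1 // => k _.
by rewrite -!mulmxA Akx -scalemxAr Kx scaler0 mulmx0.
Qed.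

Lemma cmx_exp n (A : 'M[R]_n) k : cmx (A ^+ k) = (cmx A) ^+ k.
Proof.
elim: k => [|k IH]; first by rewrite !expr0 map_mx1.
by rewrite !exprS -IH; exact: map_mxM.
Qed.

Lemma minimal_observableC m n (S : state_space R m n) G : minimal_realization S
    G ->
  exists N (X : 'I_N -> 'M[C]_(n, m)),
    1%:M = \sum_(k < N) X k *m (cmx (ssC S) *m cmx (ssA S) ^+ k).
Proof.
move=> /minimal_observable[N [X /(congr1 cmx) X1]].
exists N, (fun k => cmx (X k));
  rewrite -(map_mx1 (real_complex R)) X1 rmorph_sum /=.
by apply: eq_bigr => k _; rewrite !map_mxM cmx_exp.
Qed.

Lemma minimal_controllableC m n (S : state_space R m n) G : minimal_realization
    S G ->
  exists N (X : 'I_N -> 'M[C]_(m, n)),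
    1%:M = \sum_(k < N) cmx (ssA S) ^+ k *m cmx (ssB S) *m X k.
Proof.
move=> /minimal_controllable[N [X /(congr1 cmx) X1]].
exists N, (fun k => cmx (X k));
  rewrite -(map_mx1 (real_complex R)) X1 rmorph_sum /=.
by apply: eq_bigr => k _; rewrite !map_mxM cmx_exp.
Qed.

(** Without a pole at [s] the residue of the transfer function is 0, and by controllability so is
    that of [K (t - A)^-1 x] for every [x]. For an eigenvector [x] this residue is [K x], so
    observability gives [x = 0]. *)
Lemma minimal_pole m n (S : state_space R m n) G s : minimal_realization S G ->
  ~ tf_pole G s -> s%:M - cmx (ssA S) \in unitmx.
Proof.
move=> minS nopole; have SG := proj1 minS.
apply: contraT => /nonunit_kernel[x x0 Ax].
have [N [X X1]] := minimal_controllableC minS.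
have [N' [X' X'1]] := minimal_observableC minS.
have FF := dnbhs_filter s; have ts := tendsto_dnbhs s.
set A := cmx (ssA S) in Ax X1 X'1; set B := cmx (ssB S) in X1.
set K := cmx (ssC S) in X'1.
have h0 := tendstoB FF ts (tendsto_cst FF s).
have hL : mtendsto (s : C^o)^' (fun t =>
  (t - s) *: (K *m invmx (t%:M - A) *m B)) 0.
  have := mtendstoZ FF h0 (mtendstoD FF (mtendsto_tf_eval nopole)
    (mtendsto_cst FF (- cmx (ssD S)))).
  rewrite subrr scale0r; apply: (mtendsto_eq FF).
  move: (near_resolvent_unit A s); apply: (@filterS _ _ FF) => t /= ut.
  by rewrite -SG (ss_evalE ut).2 /ss_eval !tfunE addrK.
have [w] := residue_state X1 hL x; rewrite mul0mx => hx.
have Kx : K *m x = 0.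
  apply: (mtendsto_uniq FF _ hx);
    apply: (mtendsto_eq FF _ (mtendsto_cst FF (K *m x))).
  move: (@filterI _ _ FF _ _ (near_resolvent_unit A s) (near_dnbhs_neq s s)).
  apply: (@filterS _ _ FF) => t /= [ut tsn].
  rewrite -mulmxA scalemxAr; congr (_ *m _); rewrite scalemxAr.
  apply: (canRL (mulKmx ut)).
  have -> : t%:M - A = (t - s)%:M + (s%:M - A) by rewrite raddfB /= addrA subrK.
  by rewrite mulmxDl Ax addr0 mul_scalar_mx.
by rewrite (observable_eigenvector X'1 Ax Kx) eqxx in x0.
Qed.
End Kernel.

Section Conjugation.
Variable R : realType.
Notation C := R[i].
Notation cmx := (map_mx (real_complex R)).
Notation cj := (map_mx (@conjc R)).

Lemma horner_polyRC_conj (p : {poly R}) (s : C) :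
  (polyRC p).[s^*%C] = ((polyRC p).[s])^*%C.
Proof.
elim/poly_ind: p => [|p c IH]; first by rewrite /polyRC rmorph0 !horner0 conjc0.
rewrite /polyRC rmorphD rmorphM /= map_polyX map_polyC /= !hornerMXaddC.
by rewrite -/(polyRC p) IH rmorphD rmorphM /= oppr0.
Qed.

Lemma tf_eval_conj m (G : tfmatrix R m) (s : C) :
  tf_eval G s^*%C = cj (tf_eval G s).
Proof.
apply/matrixP => k l; rewrite !mxE /reval !horner_polyRC_conj.
by rewrite rmorphM /= fmorphV.
Qed.

Lemma tf_pole_conj m (G : tfmatrix R m) (s : C) : tf_pole G s ->
    tf_pole G s^*%C.
Proof.
move=> [k [l]]; rewrite pole_order_gt0 => /eqP h; exists k, l.
by rewrite pole_order_gt0 horner_polyRC_conj h conjc0.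
Qed.

Lemma jomegaN (w : R) : jomega (- w) = (jomega w)^*%C.
Proof. by []. Qed.

Lemma dotc_conj n (x y : 'cV[C]_n) : dotc (cj x) (cj y) = (dotc x y)^*%C.
Proof.
rewrite !dotcE rmorph_sum; apply: eq_bigr => k _.
by rewrite !mxE rmorphM.
Qed.

Lemma cjK p q (x : 'M[C]_(p, q)) : cj (cj x) = x.
Proof. by apply/matrixP => i j; rewrite !mxE conjcK. Qed.

Lemma cj_eq0 p q (x : 'M[C]_(p, q)) : (cj x == 0) = (x == 0).
Proof.
by apply/eqP/eqP => [h|->]; [rewrite -[x]cjK h map_mx0|rewrite map_mx0].
Qed.

Lemma cj_cmx p q (X : 'M[R]_(p, q)) : cj (cmx X) = cmx X.
Proof. by apply/matrixP => i j; rewrite !mxE conjc_real. Qed.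

Lemma dotc_cjl m n (M : 'M[C]_(m, n)) y z :
  dotc (cj y) (M *m cj z) = (dotc y (cj M *m z))^*%C.
Proof. by rewrite -dotc_conj map_mxM cjK. Qed.

Lemma tendsto_conj_dnbhs (b l : C) (f : C -> C) :
  tendsto (b : C^o)^' f l -> tendsto (b^*%C : C^o)^' (fun s =>
    (f s^*%C)^*%C) l^*%C.
Proof.
have F1 := dnbhs_filter b; have F2 := dnbhs_filter b^*%C.
move=> /(tendstoP F1) h; apply/(tendstoP F2) => e /h.
move=> /nbhs_complexP[d d0 hd]; apply/nbhs_complexP; exists d => // s.
have -> : `|b^*%C - s| = `|b - s^*%C|.
  by rewrite -(normcJ (b^*%C - s)) [X in `|X|]rmorphB /= conjcK.
move=> /hd {}hd sb /=.
rewrite -rmorphB normcJ; apply: hd; apply: contra sb => /eqP <-.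
by rewrite conjcK.
Qed.

Lemma psdmx_form m (X : 'M[C]_m) : psdmx X ->
  X^t* = X /\ forall y, 0 <= dotc y (X *m y).
Proof.
move=> [/is_hermitianmxP]; rewrite expr0 scale1r => XE h; split=> // y.
by rewrite !dotc_mx mulmxA.
Qed.

Lemma skew_form m (M : 'M[C]_m) (y : 'cV[C]_m) :
  (y^t* *m ('i%C *: (M - M^t* )) *m y) 0 0 =
  (- (2 * complex.Im (dotc y (M *m y))))%:C.
Proof.
rewrite -mulmxA -dotc_mx -scalemxAl dotcZr mulmxBl dotcBr -dotc_mull.
rewrite [dotc (M *m y) y]dotcC subcJ mulrC -!mulrA -expr2 sqr_i mulrN1 mulrN.
by rewrite rmorphN rmorphM rmorph_nat.
Qed.
End Conjugation.

Section NegativeImaginary.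
Variables (R : realType) (m : nat).
Notation C := R[i].
Implicit Types (G H : tfmatrix R m).

(** Going from [w] to [- w] and conjugating [y] flips the sign of the imaginary part; the factor [w]
    covers both signs at once. *)
Lemma ni_axis G w y : negative_imaginary G -> w != 0 ->
    ~ tf_pole G (jomega w) ->
  w * complex.Im (dotc y (tf_eval G (jomega w) *m y)) <= 0.
Proof.
move=> [_ niG _].
have pos v z : 0 < v -> ~ tf_pole G (jomega v) ->
    complex.Im (dotc z (tf_eval G (jomega v) *m z)) <= 0.
  move=> v0 npole; have [_ /(_ z)] := niG v v0 npole; rewrite skew_form lecR.
  by rewrite oppr_ge0 pmulr_rle0.
case: (ltgtP w 0) => // w0 _ npole; last by rewrite pmulr_rle0 // pos.
have vp : 0 < - w by rewrite oppr_gt0.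
have np : ~ tf_pole G (jomega (- w)).
  by move=> /tf_pole_conj; rewrite -jomegaN opprK.
have := pos _ (map_mx (@conjc R) y) vp np.
rewrite jomegaN tf_eval_conj dotc_cjl cjK.
by case: (dotc _ _) => a b /=; rewrite nmulr_rle0 // oppr_le0.
Qed.

Lemma sni_axis H w y : strictly_negative_imaginary H -> w != 0 -> y != 0 ->
  w * complex.Im (dotc y (tf_eval H (jomega w) *m y)) < 0.
Proof.
move=> [_ sniH].
have pos v z : 0 < v -> z != 0 ->
    complex.Im (dotc z (tf_eval H (jomega v) *m z)) < 0.
  move=> v0 z0; have [_ /(_ z z0)] := sniH v v0; rewrite skew_form (ltcR 0).
  by rewrite oppr_gt0 pmulr_rlt0.
case: (ltgtP w 0) => // w0 _ y0; last by rewrite pmulr_rlt0 // pos.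
have vp : 0 < - w by rewrite oppr_gt0.
have := pos _ (map_mx (@conjc R) y) vp; rewrite cj_eq0 => /(_ y0).
rewrite jomegaN tf_eval_conj dotc_cjl cjK.
by case: (dotc _ _) => a b /=; rewrite nmulr_rlt0 // oppr_lt0.
Qed.

Lemma ni_pole G w : negative_imaginary G -> w != 0 -> tf_pole G (jomega w) ->
  exists K0 : 'M[C]_m, [/\
    mtendsto (jomega w : C^o)^' (fun s =>
      ((s - jomega w) * s) *: tf_eval G s) K0,
    K0^t* = K0 & forall y, 0 <= dotc y (K0 *m y)].
Proof.
move=> [_ _ niG].
have pos v : 0 < v -> tf_pole G (jomega v) ->
  exists K0 : 'M[C]_m, [/\
    mtendsto (jomega v : C^o)^' (fun s =>
      ((s - jomega v) * s) *: tf_eval G s) K0,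
    K0^t* = K0 & forall y, 0 <= dotc y (K0 *m y)].
  move=> v0 pole; have [_ [K0 hK /psdmx_form[Kh K0p]]] := niG v v0 pole.
  exists K0; split=> // k l; have FF := dnbhs_filter (jomega v).
  have /tendstoE := hK k l; apply: (tendsto_ext FF) => s.
  by rewrite [RHS]mxE.
case: (ltgtP w 0) => // w0 _ pole; last exact: pos.
have vp : 0 < - w by rewrite oppr_gt0.
have pole' : tf_pole G (jomega (- w)) by rewrite jomegaN; apply: tf_pole_conj.
have [K0 [hK Kh K0p]] := pos _ vp pole'.
exists (map_mx (@conjc R) K0); split.
- move=> k l; have := tendsto_conj_dnbhs (hK k l).
  rewrite -jomegaN opprK mxE; have FF := dnbhs_filter (jomega w).
  apply: (tendsto_ext FF) => s;
    rewrite [in RHS]mxE [in LHS]mxE tf_eval_conj mxE.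
  by rewrite jomegaN -rmorphB -!rmorphM /= conjcK.
- by rewrite -[in RHS]Kh; apply/matrixP => i j; rewrite !mxE.
- by move=> y; rewrite -[y]cjK dotc_cjl cjK conj_ge0.
Qed.
End NegativeImaginary.

(** * Realizations of negative imaginary systems *)

Section Forms.
Variable R : realType.
Notation C := R[i].
Notation cmx := (map_mx (real_complex R)).
Notation cj := (map_mx (@conjc R)).

(** For real [M], conjugating [v] flips the sign, so the one-sided bound is an equality. *)
Lemma real_form_Im0 n (M : 'M[C]_n) : cj M = M ->
  (forall v, complex.Im (dotc v (M *m v)) <= 0) ->
  forall v, complex.Im (dotc v (M *m v)) = 0.
Proof.
move=> rM h v; apply/eqP; rewrite eq_le h /=.
have := h (cj v); rewrite dotc_cjl rM.
by case: (dotc _ _) => a b /=; rewrite oppr_le0.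
Qed.

(** Polarization, first with [u + v], then with ['i *: v]. *)
Lemma hermitian_form n (M : 'M[C]_n) :
  (forall v, complex.Im (dotc v (M *m v)) = 0) -> M^t* = M.
Proof.
move=> h.
have h1 u v : complex.Im (dotc u (M *m v)) = - complex.Im (dotc v (M *m u)).
  have := h (u + v); rewrite mulmxDr dotcDl !dotcDr !ImD (h u) (h v) add0r
    addr0.
  by move/eqP; rewrite addr_eq0 => /eqP.
have h2 u v : complex.Re (dotc u (M *m v)) = complex.Re (dotc v (M *m u)).
  have := h1 u ('i%C *: v); rewrite -scalemxAr dotcZr dotcZl.
  case: (dotc _ _) => a b; case: (dotc _ _) => c d /=; lra.
have h3 u v : dotc u (M^t* *m v) = dotc u (M *m v).
  rewrite -dotc_mull dotcC; have := h1 u v; have := h2 u v.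
  by case: (dotc u _) => a b; case: (dotc v _) => c d /= -> ->.
apply/matrixP => i j.
have := h3 (delta_mx i 0) (delta_mx j 0); rewrite !dotcE.
have aux (N : 'M[C]_n) : \sum_k ((delta_mx i 0 : 'cV[C]_n) k 0)^*%C *
    (N *m (delta_mx j 0 : 'cV[C]_n)) k 0 = N i j.
  rewrite (bigD1 i) //= big1 => [|k ki].
    by rewrite -colE [delta_mx _ _ _ _]mxE !eqxx conjc_nat mul1r addr0 mxE.
  by rewrite [delta_mx _ _ _ _]mxE (negPf ki) conjc_nat mul0r.
by rewrite !aux.
Qed.

Lemma hermitian_Im0 n (M : 'M[C]_n) v : M^t* = M ->
    complex.Im (dotc v (M *m v)) = 0.
Proof.
move=> hM; have := Im_dotcC v (M *m v); rewrite dotc_mull hM.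
by move=> /eqP; rewrite -subr_eq0 opprK -mulr2n mulrn_eq0 => /eqP.
Qed.
End Forms.

Section Systems.
Variables (R : realType) (m : nat).
Notation C := R[i].
Notation cmx := (map_mx (real_complex R)).
Notation cj := (map_mx (@conjc R)).

Section AxisLimits.
Variables (n : nat) (A : 'M[C]_n) (B : 'M[C]_(n, m)) (K : 'M[C]_(m,
  n)) (D : 'M[C]_m).
Let G := tfun A B K D.
Hypothesis G_axis : forall w y, w != 0 -> (jomega w)%:M - A \in unitmx ->
  w * complex.Im (dotc y (G (jomega w) *m y)) <= 0.

Let Re_Ni (z : C) : complex.Re (- 'i%C * z) = complex.Im z.
Proof. by case: z => a b; simpc. Qed.

(** A limit along the positive axis. With [real_form_Im0] and [hermitian_form], this and its
    analogue at 0 make [D] and [G 0] Hermitian for real systems. *)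
Lemma tfun_infty_Im_le0 y : complex.Im (dotc y (D *m y)) <= 0.
Proof.
have FF : Filter (cinfty_nbhs R) by exact: (@filter_filter _ _
  (cinfty_nbhs_filter R)).
have h : tendsto (cinfty_nbhs R) (fun s => dotc y (G s *m y)) (dotc y (D *m y)).
  have := tendstoD FF (tendsto_resolvent_infty A (y^t* *m K) (B *m y))
    (tendsto_cst FF (dotc y (D *m y))).
  rewrite add0r; apply: (tendsto_ext FF) => s.
  by rewrite /G !tfunE mulmxDl dotcDr !dotc_mx !mulmxA.
rewrite leNgt; apply/negP => D0.
have := tendsto_Re_gt (x := 0) (tendstoZ FF (- 'i%C) h).
rewrite Re_Ni => /(_ D0) h1.
have [M hM] := near_axis_cinfty (@filterI _ _ FF _ _ h1 (near_cinfty_unit A)).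
have Mw : M < `|M| + 1 by rewrite (le_lt_trans (ler_norm _)) // ltrDl.
have w0 : 0 < `|M| + 1 by rewrite ltr_pwDr.
have [] := hM _ Mw; rewrite /= Re_Ni => h2 h3.
by have := G_axis y (lt0r_neq0 w0) h3; rewrite pmulr_rle0 // leNgt h2.
Qed.

Lemma tfun_zero_Im_le0 y : 0%:M - A \in unitmx ->
  complex.Im (dotc y (G 0 *m y)) <= 0.
Proof.
move=> u0; have FF := dnbhs_filter (0 : C).
have h : tendsto (0 : C^o)^' (fun s => dotc y (G s *m y)) (dotc y (G 0 *m y)).
  have q0 : (char_poly A).[0] != 0 by rewrite -resolvent_unit.
  have := tendstoD FF (tendsto_ratio FF (ss_num A (y^t* *m K) (B *m y)) q0
    (tendsto_dnbhs (0 : C))) (tendsto_cst FF (dotc y (D *m y))).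
  rewrite -ss_numE //.
  have GE s : dotc y (G s *m y) =
      (y^t* *m K *m invmx (s%:M - A) *m (B *m y)) 0 0 + dotc y (D *m y).
    by rewrite /G !tfunE mulmxDl dotcDr !dotc_mx !mulmxA.
  rewrite [X in _ -> tendsto _ _ X](GE 0); apply: (tendsto_eq FF).
  move: (near_resolvent_unit A 0); apply: (@filterS _ _ FF) => s /= us.
  by rewrite GE -ss_numE.
rewrite leNgt; apply/negP; have [z0 z0E] : exists z0, z0 = dotc y (G 0 *m y).
  by eexists.
rewrite -z0E in h *; move=> D0.
have := tendsto_Re_gt (x := 0) (tendstoZ FF (- 'i%C) h).
rewrite Re_Ni => /(_ D0) h1.
have := @near_jomega_dnbhs R 0 _ (@filterI _ _ FF _ _ h1 (near_resolvent_unit A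
  0)).
move=> /nbhs_ballP[e /= e0 he].
have e2 : 0 < e / 2 by rewrite divr_gt0.
have hb : ball (0 : R) e (e / 2).
  by rewrite -ball_normE /ball_ /= sub0r normrN gtr0_norm // ltr_pdivrMr //
    ltr_pMr // ltr1n.
have [h2 h3] := he _ hb (lt0r_neq0 e2).
rewrite /= Re_Ni in h2.
by have := G_axis y (lt0r_neq0 e2) h3; rewrite pmulr_rle0 // leNgt h2.
Qed.
End AxisLimits.

(* The NI condition on the axis and the residue condition are imposed for both
   signs of [w]; for real systems the negative half follows by conjugation. *)
Definition ni_system n (A : 'M[C]_n) (B : 'M[C]_(n, m)) (K : 'M[C]_(m, n))
    (D : 'M[C]_m) : Prop :=
  [/\ forall s, 0 < complex.Re s -> s%:M - A \in unitmx,
      0%:M - A \in unitmx,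
      D^t* = D /\ (tfun A B K D 0)^t* = tfun A B K D 0,
      forall w y, w != 0 -> (jomega w)%:M - A \in unitmx ->
        w * complex.Im (dotc y (tfun A B K D (jomega w) *m y)) <= 0
    & forall w, w != 0 -> (jomega w)%:M - A \notin unitmx ->
        exists K0 : 'M[C]_m, [/\ mtendsto (jomega w : C^o)^'
          (fun s => ((s - jomega w) * s) *: tfun A B K D s) K0,
          K0^t* = K0 & forall y, 0 <= dotc y (K0 *m y)]].

Definition sni_system n (A : 'M[C]_n) (B : 'M[C]_(n, m)) (K : 'M[C]_(m, n))
    (D : 'M[C]_m) : Prop :=
  [/\ forall s, 0 <= complex.Re s -> s%:M - A \in unitmx,
      D^t* = D /\ (tfun A B K D 0)^t* = tfun A B K D 0 &
      forall w y, w != 0 -> y != 0 ->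
        w * complex.Im (dotc y (tfun A B K D (jomega w) *m y)) < 0].

Lemma hermitian_ends n (S : state_space R m n) :
  0%:M - cmx (ssA S) \in unitmx ->
  (forall w y, w != 0 -> (jomega w)%:M - cmx (ssA S) \in unitmx ->
    w * complex.Im (dotc y (ss_eval S (jomega w) *m y)) <= 0) ->
  (cmx (ssD S))^t* = cmx (ssD S) /\ (ss_eval S 0)^t* = ss_eval S 0.
Proof.
move=> u0 ax; split; apply: hermitian_form; apply: real_form_Im0.
- exact: cj_cmx.
- by move=> v; exact: tfun_infty_Im_le0 ax v.
- have [_ <-] := ss_evalE u0.
  by rewrite -[in RHS](conjc0 R) tf_eval_conj.
- by move=> v; exact: tfun_zero_Im_le0 ax v u0.
Qed.

Lemma ni_realization n (S : state_space R m n) G :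
  minimal_realization S G -> negative_imaginary G ->
  ni_system (cmx (ssA S)) (cmx (ssB S)) (cmx (ssC S)) (cmx (ssD S)).
Proof.
move=> minS niG; have [SG _] := minS.
have [[np0 nprhp] _ _] := niG.
have u0 := minimal_pole minS np0.
have ax w y : w != 0 -> (jomega w)%:M - cmx (ssA S) \in unitmx ->
    w * complex.Im (dotc y (ss_eval S (jomega w) *m y)) <= 0.
  move=> w0 /ss_evalE[]; rewrite SG => np <-; exact: ni_axis.
split; [by move=> s /nprhp /(minimal_pole minS)|exact: u0| |exact: ax|].
  exact: (hermitian_ends u0 ax).
move=> w w0 nu.
have pole : tf_pole G (jomega w).
  by apply: contrapT => /(minimal_pole minS); apply/negP.
have [K0 [hK Kh Kp]] := ni_pole niG w0 pole; exists K0; split;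
  [|exact: Kh|exact: Kp].
have FF := dnbhs_filter (jomega w).
apply: (mtendsto_eq FF _ hK).
move: (near_resolvent_unit (cmx (ssA S)) (jomega w)).
by apply: (@filterS _ _ FF) => t /= /ss_evalE[_]; rewrite SG => ->.
Qed.

Lemma sni_realization n (S : state_space R m n) H :
  minimal_realization S H -> strictly_negative_imaginary H ->
  sni_system (cmx (ssA S)) (cmx (ssB S)) (cmx (ssC S)) (cmx (ssD S)).
Proof.
move=> minS sniH; have [SH _] := minS.
have uA s : 0 <= complex.Re s -> s%:M - cmx (ssA S) \in unitmx.
  by move=> /(proj1 sniH) /(minimal_pole minS).
have ax w y : w != 0 -> y != 0 ->
    w * complex.Im (dotc y (ss_eval S (jomega w) *m y)) < 0.
  move=> w0 y0; have [|_] := @ss_evalE _ _ _ S (jomega w); first exact: uA.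
  by rewrite SH => <-; exact: sni_axis.
split; [exact: uA| |exact: ax]; apply: hermitian_ends; first exact: uA.
move=> w y w0 _; have [->|y0] := eqVneq y 0; last by rewrite ltW ?ax.
by rewrite dotc0l mulr0.
Qed.
End Systems.

(** * Passivity in the right half plane *)

Section Passivity.
Variables (R : realType) (m : nat).
Notation C := R[i].

Lemma Re_inv_gt0 (s : C) : 0 < complex.Re s -> 0 < complex.Re s^-1.
Proof.
case: s => a b /= a0; rewrite divr_gt0 //.
by rewrite ltr_pwDl ?exprn_gt0 ?sqr_ge0.
Qed.

Lemma Re_realM_div (x s : C) : complex.Im x = 0 ->
  complex.Re (x / s) = complex.Re x * complex.Re s^-1.
Proof.
by move=> x0; rewrite [x in LHS](_ : x = (complex.Re x)%:C) ?Re_realM //;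
  case: x x0 => a b /= ->.
Qed.

Lemma le_of_perturbation (a b k : R) :
  (forall e, 0 < e -> a <= b + e * k) -> a <= b.
Proof.
move=> h; rewrite leNgt; apply/negP => ba.
(* Chosen so that [e * k] is at most half of the gap [a - b]; the [+ 1] covers [k = 0]. *)
pose e := (a - b) / (2 * (`|k| + 1)).
have k1 : 0 < `|k| + 1 by rewrite ltr_pwDr.
have e0 : 0 < e by rewrite divr_gt0 ?subr_gt0 // mulr_gt0.
have : e * k <= (a - b) / 2.
  have -> : e * k = (a - b) / 2 * (k / (`|k| + 1)).
    by rewrite /e; field; exact: lt0r_neq0.
  rewrite -[leRHS]mulr1 ler_wpM2l //; first by rewrite divr_ge0 // subr_ge0 ltW.
  rewrite ler_pdivrMr // mul1r; have := ler_norm k; lra.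
by have := h e e0; lra.
Qed.

(** Used with [M p = v] fixed: it bounds the form of [M^-1] at [v] below by an expression affine in
    [M]. *)
Lemma complete_square (M : 'M[C]_m) p z : M^t* = M ->
  0 <= complex.Re (dotc (p - z) (M *m (p - z))) ->
  2 * complex.Re (dotc z (M *m p)) - complex.Re (dotc z (M *m z)) <=
  complex.Re (dotc (M *m p) p).
Proof.
move=> Mh; rewrite mulmxBr dotcBl !dotcBr !ReB.
rewrite (Re_dotcC (M *m z) p) dotc_mull Mh (Re_dotcC (M *m p) p).
set a := complex.Re _; set b := complex.Re _; set c := complex.Re _.
by clearbody a b c; lra.
Qed.

Section NegativeImaginary.
Variables (n : nat) (A : 'M[C]_n) (B : 'M[C]_(n, m)) (K : 'M[C]_(m,
  n)) (D : 'M[C]_m).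
Let G := tfun A B K D.
Hypothesis niG : ni_system A B K D.

Lemma ni_passive s y u u0 : 0 < complex.Re s -> u = G s *m y -> u0 = G 0 *m y ->
  complex.Re (dotc y u / s) <= complex.Re (dotc y u0) * complex.Re s^-1.
Proof.
move=> s0 -> ->; have [uA unit0 [_ G0h] ax pole] := niG.
rewrite -Re_realM_div; last exact: hermitian_Im0.
rewrite -subr_le0 -ReB -mulrBl -dotcBr -mulmxBl.
apply: (ni_positive_real_inv (oner_neq0 _) uA unit0 _ _ _ s0).1.
- exact: hermitian_Im0.
- by move=> w w0 uw _; exact: ax.
- move=> w w0 nu; have [K0 [hK Kh Kp]] := pole w w0 nu.
  have := Kp y; rewrite lecE => /andP[/eqP Im0 Re0].
  exists (complex.Re (dotc y (K0 *m y))) => //.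
  have FF := dnbhs_filter (jomega w).
  have := mtendsto_dotc FF y (mtendstoM FF hK (mtendsto_cst FF y)).
  rewrite [X in tendsto _ _ X](_ : _ = (complex.Re (dotc y (K0 *m y)))%:C).
    by apply: (tendsto_ext FF) => t; rewrite -scalemxAl dotcZr.
  by case: (dotc _ _) Im0 {Re0} => a b /= ->.
Qed.
End NegativeImaginary.

Section StrictlyNegativeImaginary.
Variables (n : nat) (A : 'M[C]_n) (B : 'M[C]_(n, m)) (K : 'M[C]_(m,
  n)) (D : 'M[C]_m).
Let H := tfun A B K D.
Hypothesis sniH : sni_system A B K D.
Hypothesis D_ge0 : forall y, 0 <= complex.Re (dotc y (D *m y)).

Let H_axis_le w y : w != 0 -> w * complex.Im (dotc y (H (jomega w) *m y)) <= 0.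
Proof.
move=> w0; have [->|y0] := eqVneq y 0; first by rewrite dotc0l mulr0.
by have [_ _ ax] := sniH; rewrite ltW // ax.
Qed.

Lemma sni_ge_infty s y : 0 < complex.Re s ->
  complex.Re s * complex.Re (dotc y (D *m y)) <= complex.Re (s * dotc y (H s *m
    y)).
Proof.
move=> s0; have [uA [Dh _] ax] := sniH.
have := ni_positive_real (oner_neq0 _) uA (hermitian_Im0 y Dh)
  (fun w w0 _ => H_axis_le y w0) s0.
rewrite mulmxBl dotcBr mulrBr ReB subr_ge0; apply: le_trans.
have := hermitian_Im0 y Dh; case: (dotc y (D *m y)) => a b /= ->.
by case: (s) => c d /=; rewrite mulr0 subr0.
Qed.

(** At [s = 1] both positive-real inequalities compare values of [H]: [H(0) > H(1) >= H(oo) >= 0].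
    The first is strict, since equality would make the form vanish on the axis. *)
Lemma sni_dc_gt0 y : y != 0 -> 0 < complex.Re (dotc y (H 0 *m y)).
Proof.
move=> y0; have [uA [_ H0h] ax] := sniH.
have one_gt0 : 0 < complex.Re (1 : C) by exact: ltr01.
have uA' s : 0 < complex.Re s -> s%:M - A \in unitmx by move=> /ltW /uA.
have uj w : (jomega w)%:M - A \in unitmx by exact: uA.
have [h1 h2] := ni_positive_real_inv (oner_neq0 _) uA' (uA 0 (lexx _))
  (hermitian_Im0 y H0h) (fun w w0 _ _ => H_axis_le y w0)
  (fun w w0 nu => False_ind _ (elimT negP nu (uj w))) one_gt0.
have h3 : complex.Re (dotc y ((H 1 - H 0) *m y) / 1) < 0.
  rewrite lt_neqAle h1 andbT; apply/negP => /eqP eq0.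
  have := ax 1 y (oner_neq0 _) y0.
  by rewrite (h2 _ 1 (oner_neq0 _) (uj 1)) ?mulr0 ?ltxx // eq0.
rewrite divr1 mulmxBl dotcBr ReB subr_lt0 in h3; apply: le_lt_trans h3.
have := sni_ge_infty y one_gt0; rewrite [in X in _ <= X -> _]mul1r;
  apply: le_trans.
by rewrite mulr_ge0 ?D_ge0 // ltW.
Qed.

(** On a kernel vector the form of [H s] would be real and negative. This is excluded by
    [sni_ge_infty] in the open half plane, by [sni_dc_gt0] at 0, and by strictness elsewhere on the
    axis. *)
Lemma sni_regularized_unit e s : 0 < e -> 0 <= complex.Re s ->
  H s + e%:C%:M \in unitmx.
Proof.
move=> e0 s0; have [uA [Dh H0h] ax] := sniH.
apply: contraT => /nonunit_kernel[y y0 Hy].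
have yy := dotc_gt0 y0.
have yIm : complex.Im (dotc y y) = 0.
  by have := Im_dotcC y y; lra.
have : dotc y (H s *m y) = - (e%:C * dotc y y).
  apply/eqP; rewrite -addr_eq0 -dotcZr -dotcDr -mul_scalar_mx -mulmxDl Hy.
  by rewrite dotc0r.
move=> hy; have {}hy : dotc y (H s *m y) = (- (e * complex.Re (dotc y y)))%:C.
  rewrite hy; case: (dotc y y) yIm => a b /= ->.
  by rewrite rmorphN rmorphM.
have pos : 0 < e * complex.Re (dotc y y) by rewrite mulr_gt0.
move: s0; rewrite le_eqVlt => /orP[/eqP s0|s0]; last first.
  have := sni_ge_infty y s0; rewrite hy [s * _]mulrC Re_realM => h.
  have := mulr_ge0 (ltW s0) (D_ge0 y).
  have := mulr_gt0 pos s0; lra.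
have sE : s = jomega (complex.Im s) by case: (s) s0 => a b /= <-.
have [w0|w0] := eqVneq (complex.Im s) 0.
  have := sni_dc_gt0 y0; rewrite [X in H X](_ : 0 = s) ?hy /=; first lra.
  by rewrite sE w0.
by have := ax _ y w0 y0; rewrite -sE -/(H s) hy /= mulr0 ltxx.
Qed.
End StrictlyNegativeImaginary.

Section InverseSystem.
Variables (n : nat) (A : 'M[C]_n) (B : 'M[C]_(n, m)) (K : 'M[C]_(m,
  n)) (D : 'M[C]_m).
Let N := tfun A B K D.
Hypothesis uD : D \in unitmx.
Let A' := A - B *m invmx D *m K.

(** An eigenvector of [A'] is a state whose output is held at 0 by the input [u = - D^-1 K x]; hence
    [N s] kills [u]. *)
Lemma inverse_system_unit s : s%:M - A \in unitmx -> N s \in unitmx ->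
  s%:M - A' \in unitmx.
Proof.
move=> us uN; apply: contraT => /nonunit_kernel[x x0].
rewrite /A' opprB addrCA mulmxDl => /eqP; rewrite addr_eq0 => /eqP Ax.
pose u := - (invmx D *m (K *m x)).
have xE : x = invmx (s%:M - A) *m (B *m u).
  by apply: (canRL (mulKmx us)); rewrite /u mulmxN !mulmxA Ax opprK.
have : N s *m u = 0.
  rewrite /N !tfunE mulmxDl -!mulmxA -xE /u mulmxN mulKVmx // subrr //.
move=> /(unit_kernel uN) u0.
by move: x0; rewrite xE u0 !mulmx0 eqxx.
Qed.

Lemma inverse_systemE s : s%:M - A \in unitmx -> N s \in unitmx ->
  tfun A' (B *m invmx D) (invmx D *m K) (- invmx D) s = - invmx (N s).
Proof.
move=> us uN; have us' := inverse_system_unit us uN.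
rewrite !tfunE; set X' := invmx (s%:M - A').
apply: (canRL (@opprK _)); rewrite -[invmx (N s)]mulmx1.
apply: (canRL (mulKmx uN)).
rewrite opprD opprK mulmxDr mulmxN /N !tfunE.
set X := invmx (s%:M - A).
have XX : X *m (B *m invmx D *m K) *m X' = X - X'.
  have -> : B *m invmx D *m K = (s%:M - A') - (s%:M - A).
    by apply/esym/eqP; rewrite subr_eq /A' opprB addrCA.
  by rewrite mulmxBr mulmxBl mulVmx // mul1mx -mulmxA mulmxV // mulmx1.
rewrite !mulmxDl mulmxV // !mulmxA mulmxV // mul1mx.
have -> : K *m X *m B *m invmx D *m K *m X' *m B *m invmx D =
    K *m (X *m (B *m invmx D *m K) *m X') *m B *m invmx D by rewrite !mulmxA.
by rewrite XX mulmxBr !mulmxBl subrK addKr.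
Qed.
End InverseSystem.

Section InversePassivity.
Variables (n : nat) (A : 'M[C]_n) (B : 'M[C]_(n, m)) (K : 'M[C]_(m,
  n)) (D : 'M[C]_m).
Let H := tfun A B K D.
Hypothesis sniH : sni_system A B K D.
Hypothesis D_ge0 : forall y, 0 <= complex.Re (dotc y (D *m y)).

Let hermitian_regularized (M : 'M[C]_m) (e : R) : M^t* = M ->
  (M + e%:C%:M)^t* = M + e%:C%:M.
Proof.
move=> Mh; rewrite linearD map_mxD /= Mh tr_scalar_mx map_scalar_mx.
congr (_ + _%:M); exact: conjc_real.
Qed.

Let form_regularized (M : 'M[C]_m) (e : R) z x :
  dotc z ((M + e%:C%:M) *m x) = dotc z (M *m x) + e%:C * dotc z x.
Proof. by rewrite mulmxDl mul_scalar_mx dotcDr dotcZr. Qed.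

Let Im_dotc_diag (z : 'cV[C]_m) : complex.Im (dotc z z) = 0.
Proof. by have := Im_dotcC z z; lra. Qed.

(* [- (H + e)^-1] is again negative imaginary, so [ni_positive_real_inv]
   applies to it; the shift by [e] makes the inverse proper. *)
Let regularized_inverse_passive e s u (N := fun t => H t + e%:C%:M)
    (v := N s *m u) : 0 < e -> 0 < complex.Re s ->
  complex.Re (dotc v (invmx (N 0) *m v)) * complex.Re s^-1 <=
  complex.Re (dotc v u / s).
Proof.
move=> e0 s0; have [uA [Dh H0h] ax] := sniH.
have NE t : N t = tfun A B K (D + e%:C%:M) t by rewrite /N /H !tfunE addrA.
have uN t : 0 <= complex.Re t -> tfun A B K (D + e%:C%:M) t \in unitmx.
  by move=> t0; rewrite -NE; exact: sni_regularized_unit sniH D_ge0 _ _ e0 t0.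
have uE : D + e%:C%:M \in unitmx.
  apply: contraT => /nonunit_kernel[y y0 Ey].
  have := congr1 (@complex.Re R) (form_regularized D e y y).
  rewrite Ey dotc0r ReD Re_realM /=.
  by have := D_ge0 y; have := mulr_gt0 e0 (dotc_gt0 y0); lra.
set E := D + e%:C%:M in NE uN uE.
have uA' t : 0 <= complex.Re t -> t%:M - (A - B *m invmx E *m K) \in unitmx.
  by move=> t0; apply: inverse_system_unit; [exact: uE|exact: uA|exact: uN].
have invE t : 0 <= complex.Re t -> tfun (A - B *m invmx E *m K) (B *m invmx E)
    (invmx E *m K) (- invmx E) t = - invmx (N t).
  move=> t0; rewrite NE; apply: inverse_systemE;
    [exact: uE|exact: uA|exact: uN].
have N0h : (N 0)^t* = N 0 by exact: hermitian_regularized.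
have uN0 t : 0 <= complex.Re t -> N t \in unitmx by rewrite NE; exact: uN.
(* The substitution [y = N t z] turns the form of [- (N t)^-1] into that of [H t]; the shift by [e]
   adds only a real number. *)
have formN t y : 0 <= complex.Re t ->
    complex.Im (dotc y (- invmx (N t) *m y)) =
    complex.Im (dotc (invmx (N t) *m y) (H t *m (invmx (N t) *m y))).
  move=> t0; set z := invmx (N t) *m y.
  have yE : y = N t *m z by rewrite /z mulKVmx // uN0.
  rewrite mulNmx -/z yE dotcNr ImN -Im_dotcC form_regularized ImD.
  have := Im_dotc_diag z; case: (dotc z z) => a b /= ->.
  by rewrite mul0r mulr0 !addr0.
clearbody N.
have Re00 : 0 <= complex.Re (0 : C) by [].
have Rej w : 0 <= complex.Re (jomega w : C) by [].
have := (ni_positive_real_inv (oner_neq0 _) (fun t t0 =>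
  uA' t (ltW t0)) (uA' 0 Re00)
  (y := v) (B := B *m invmx E) (K := invmx E *m K) (D := - invmx E) _ _ _ s0).1.
rewrite !invE ?(ltW s0) // => h.
have {}h : complex.Re (dotc v ((- invmx (N s) - - invmx (N 0)) *m v) / s) <= 0.
  apply: h.
  - exact: (etrans (formN 0 v Re00) (hermitian_Im0 (invmx (N 0) *m v) H0h)).
  - move=> w w0 uw _; rewrite invE // formN //.
    have [->|z0] := eqVneq (invmx (N (jomega w)) *m v) 0.
      by rewrite dotc0l mulr0.
    by rewrite ltW // ax.
  - by move=> w w0 /negP[]; exact: uA'.
have N0v : complex.Im (dotc v (invmx (N 0) *m v)) = 0.
  have := etrans (formN 0 v Re00) (hermitian_Im0 (invmx (N 0) *m v) H0h).
  by rewrite mulNmx dotcNr ImN => /eqP; rewrite oppr_eq0 => /eqP.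
have vE : invmx (N s) *m v = u by rewrite /v mulKmx // uN0 // ltW.
clearbody v; move: (invmx (N s)) (invmx (N 0)) h vE N0v => P Q h Pv N0v.
rewrite -Re_realM_div // -subr_le0 -ReB -mulrBl -dotcBr; move: h.
by rewrite opprK mulmxDl mulNmx Pv addrC.
Qed.

Lemma sni_inverse_passive s u y z : 0 < complex.Re s ->
  H 0 *m z = y -> H s *m u = y ->
  complex.Re (dotc z y) * complex.Re s^-1 <= complex.Re (dotc y u / s).
Proof.
move=> s0 z_y u_y; have [uA [Dh H0h] ax] := sniH.
pose t := complex.Re s^-1.
have t0 : 0 < t by exact: Re_inv_gt0.
(* The coefficient of [e] in the lower bound given by [complete_square]. *)
pose c := 2 * complex.Re (dotc z u) - complex.Re (dotc z z).
apply: (@le_of_perturbation _ _ (complex.Re (dotc u u / s) - c * t)) => e e0.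
pose N t := H t + e%:C%:M; pose v := N s *m u.
have Re00 : 0 <= complex.Re (0 : C) by [].
have uN0 : N 0 \in unitmx by exact: sni_regularized_unit sniH D_ge0 _ _ e0 Re00.
pose p := invmx (N 0) *m v.
have vE : v = y + e%:C *: u by rewrite /v /N mulmxDl mul_scalar_mx u_y.
have vp : N 0 *m p = v by rewrite /p mulKVmx.
have N0h : (N 0)^t* = N 0 by exact: hermitian_regularized.
have h : complex.Re (dotc v p) * t <= complex.Re (dotc v u / s).
  exact: (regularized_inverse_passive u e0 s0).
have h1 : complex.Re (dotc z y) + e * c <= complex.Re (dotc v p).
  have sq : 0 <= complex.Re (dotc (p - z) (N 0 *m (p - z))).
    have [->|d0] := eqVneq (p - z) 0; first by rewrite dotc0l.
    rewrite form_regularized ReD Re_realM addr_ge0 //.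
      exact/ltW/(sni_dc_gt0 sniH D_ge0).
    by rewrite mulr_ge0 ?ltW // dotc_gt0.
  have E1 : complex.Re (dotc z (N 0 *m z)) =
      complex.Re (dotc z y) + e * complex.Re (dotc z z).
    by rewrite form_regularized ReD Re_realM z_y.
  have E2 : complex.Re (dotc z v) =
      complex.Re (dotc z y) + e * complex.Re (dotc z u).
    by rewrite vE dotcDr dotcZr ReD Re_realM.
  have := complete_square N0h sq; rewrite vp E1 E2; apply: le_trans.
  by rewrite le_eqVlt; apply/orP; left; apply/eqP; rewrite /c; ring.
have h2 : complex.Re (dotc v u / s) =
    complex.Re (dotc y u / s) + e * complex.Re (dotc u u / s).
  by rewrite vE dotcDl dotcZl mulrDl ReD /= oppr0 -mulrA Re_realM.
have h3 := ler_wpM2r (ltW t0) h1; rewrite mulrDl in h3; rewrite h2 in h.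
by rewrite mulrBr addrA lerBrDr mulrA (le_trans h3).
Qed.
End InversePassivity.
End Passivity.

(** * The feedback interconnection *)

Section Axis.
Variables (R : realType) (m n : nat).
Notation C := R[i].
Variables (A : 'M[C]_n) (B : 'M[C]_(n, m)) (K : 'M[C]_(m, n)) (D : 'M[C]_m).
Let G := tfun A B K D.
Hypothesis niG : ni_system A B K D.
Variables (N : nat) (X : 'I_N -> 'M[C]_(m, n)).
Hypothesis ctrl : 1%:M = \sum_(k < N) A ^+ k *m B *m X k.

(* At a pole [jomega w], solvability of the state equation forces [u] into the
   kernel of the residue, so that the pole contributes nothing to the supply
   rate. *)
Lemma ni_axis_state w (x : 'cV[C]_n) (u : 'cV[C]_m) : w != 0 ->
  ((jomega w)%:M - A) *m x = B *m u ->
  w * complex.Im (dotc u (K *m x + D *m u)) <= 0.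
Proof.
move=> w0 xE; have [uA u0 _ ax pole] := niG.
have [uw|nu] := boolP ((jomega w)%:M - A \in unitmx).
  have := ax w u w0 uw; rewrite !tfunE mulmxDl -!mulmxA -xE mulKmx //.
have [K0 [hK Kh Kp]] := pole w w0 nu.
set s := jomega w in hK xE nu *; set y := K *m x + D *m u.
have s0 : s != 0 by apply: contraNneq w0 => -[->].
have FF := dnbhs_filter s; have ts := tendsto_dnbhs s.
have tds := tendstoB FF ts (tendsto_cst FF s); rewrite subrr in tds.
have near_ok : (s : C^o)^' [set t | t%:M - A \in unitmx /\ t != 0].
  exact: (@filterI _ _ FF _ _ (near_resolvent_unit A s) (near_dnbhs_neq s 0)).
have hG : mtendsto (s : C^o)^' (fun t => (t - s) *: G t) (s^-1 *: K0).
  apply: (mtendsto_eq FF _ (mtendstoZ FF (tendstoV FF s0 ts) hK)).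
  move: near_ok; apply: (@filterS _ _ FF) => t /= [_ t0].
  by rewrite scalerA mulrCA mulVf // mulr1.
have hR : mtendsto (s : C^o)^'
    (fun t => (t - s) *: (K *m invmx (t%:M - A) *m B)) (s^-1 *: K0).
  have := mtendstoD FF hG (mtendstoZ FF tds (mtendsto_cst FF (- D))).
  rewrite scale0r addr0; apply: (mtendsto_eq FF).
  move: near_ok; apply: (@filterS _ _ FF) => t /= _.
  by rewrite -scalerDr /G !tfunE addrK.
have [v hv] := residue_state ctrl hR x.
have GuE t : t%:M - A \in unitmx ->
    G t *m u = y - (t - s) *: (K *m invmx (t%:M - A) *m x).
  move=> ut; rewrite /G !tfunE mulmxDl /y addrAC; congr (_ + _).
  rewrite -!mulmxA -xE scalemxAr -mulmxBr; congr (_ *m _).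
  have -> : (s%:M - A) *m x = (t%:M - A) *m x - (t - s) *: x.
    rewrite -mul_scalar_mx -mulmxBl raddfB /= opprB; congr (_ *m _).
    by rewrite [RHS]addrC addrA subrK.
  by rewrite mulmxBr mulKmx // scalemxAr.
(* The state equation keeps [G t *m u] finite at the pole: its limit differs from [y] by an element
   of the image of [K0], to which [u] is orthogonal. *)
have hGu : mtendsto (s : C^o)^' (fun t => G t *m u) (y - s^-1 *: K0 *m v).
  have := mtendstoD FF (mtendsto_cst FF y)
    (mtendstoZ FF (tendsto_cst FF (- 1)) hv).
  rewrite scaleN1r; apply: (mtendsto_eq FF).
  move: near_ok; apply: (@filterS _ _ FF) => t /= [ut _].
  by rewrite GuE // scaleN1r.
have K0u : K0 *m u = 0.
  have h1 := mtendstoM FF hG (mtendsto_cst FF u).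
  have h2 := mtendstoZ FF tds hGu; rewrite scale0r in h2.
  have : s^-1 *: K0 *m u = 0.
    apply: (mtendsto_uniq FF h1); apply: (mtendsto_eq FF _ h2).
    by move: near_ok; apply: (@filterS _ _ FF) => t /= _; rewrite scalemxAl.
  rewrite -scalemxAl => /(congr1 (fun M => s *: M)).
  by rewrite scalerA divff // scale1r scaler0.
have uK0 : dotc u (s^-1 *: K0 *m v) = 0.
  by rewrite -scalemxAl dotcZr -[K0]Kh -dotc_mull K0u dotc0l mulr0.
have := mtendsto_dotc FF u hGu; rewrite dotcBr uK0 subr0 => hd.
have := tendsto_axis (tendstoM FF ts hd) => {}hd.
have FR : ProperFilter w^' by exact: Proper_dnbhs_numFieldType.
have := tendsto_Re_ge0 FR hd; rewrite Re_jomegaM oppr_ge0; apply.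
move: (@filterI _ _ FR _ _ (near_jomega_dnbhs near_ok)
  (near_jomega_dnbhs (near_dnbhs_neq s 0))).
apply: (@filterS _ _ FR) => v' /= [[uv _] v0].
rewrite Re_jomegaM oppr_ge0 ax //.
by apply: contraNneq v0 => ->.
Qed.
End Axis.

Section Feedback.
Variables (R : realType) (m n1 n2 : nat).
Notation C := R[i].
Variables (A1 : 'M[C]_n1) (B1 : 'M[C]_(n1, m)) (K1 : 'M[C]_(m,
  n1)) (D1 : 'M[C]_m).
Variables (A2 : 'M[C]_n2) (B2 : 'M[C]_(n2, m)) (K2 : 'M[C]_(m,
  n2)) (D2 : 'M[C]_m).
Hypotheses (D12 : D1 *m D2 = 0) (D21 : D2 *m D1 = 0).
Let G := tfun A1 B1 K1 D1.
Let H := tfun A2 B2 K2 D2.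

Definition feedback : 'M[C]_(n1 + n2) :=
  block_mx (A1 + B1 *m D2 *m K1) (B1 *m K2) (B2 *m K1) (A2 + B2 *m D1 *m K2).

(* Closed loop with an external input [v] added to the input [u] of the second
   system; [y] is the output of the second system. *)
Lemma feedback_equations s (x1 : 'cV[C]_n1) (x2 : 'cV[C]_n2)
    (u y v : 'cV[C]_m) :
  u = K1 *m x1 + D1 *m y + v -> y = K2 *m x2 + D2 *m u ->
  (s%:M - feedback) *m col_mx x1 x2 = col_mx (B1 *m D2 *m v) (B2 *m v) <->
  (s%:M - A1) *m x1 = B1 *m y /\ (s%:M - A2) *m x2 = B2 *m u.
Proof.
move=> uE yE.
have D1y : D1 *m y = D1 *m K2 *m x2.
  by rewrite yE mulmxDr !mulmxA D12 mul0mx addr0.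
have D2u : D2 *m u = D2 *m K1 *m x1 + D2 *m v.
  by rewrite uE !mulmxDr !mulmxA D21 mul0mx addr0.
have -> : (s%:M - feedback) *m col_mx x1 x2 = col_mx
    ((s%:M - A1) *m x1 - (B1 *m y - B1 *m D2 *m v))
    ((s%:M - A2) *m x2 - (B2 *m u - B2 *m v)).
  rewrite mulmxBl mul_scalar_mx scale_col_mx /feedback mul_block_col opp_col_mx.
  rewrite add_col_mx !mulmxBl !mul_scalar_mx; congr col_mx.
    rewrite [in RHS]yE D2u !mulmxDr !mulmxA addrA addrK mulmxDl.
    by rewrite !opprD !addrA [_ - B1 *m K2 *m x2]addrAC.
  rewrite [in RHS]uE D1y !mulmxDr !mulmxA addrK mulmxDl.
  by rewrite addrCA opprD addrA.
split=> [/eq_col_mx[/eqP h1 /eqP h2]|[-> ->]].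
  by move: h1 h2; rewrite !subr_eq !subrKC => /eqP -> /eqP ->.
by rewrite !subKr.
Qed.

Hypothesis niG : ni_system A1 B1 K1 D1.
Hypothesis sniH : sni_system A2 B2 K2 D2.
Hypothesis D2_ge0 : forall y, 0 <= complex.Re (dotc y (D2 *m y)).

Let tfun_state (n : nat) (A : 'M[C]_n) (B : 'M[C]_(n, m)) (K : 'M[C]_(m, n))
    (D : 'M[C]_m) s x (u : 'cV[C]_m) :
  s%:M - A \in unitmx -> (s%:M - A) *m x = B *m u ->
  K *m x + D *m u = tfun A B K D s *m u.
Proof. by move=> us xE; rewrite !tfunE mulmxDl -!mulmxA -xE mulKmx. Qed.

Section Sufficiency.
Variables (N1 N2 : nat) (X1 : 'I_N1 -> 'M[C]_(m, n1))
  (X2 : 'I_N2 -> 'M[C]_(n1, m)).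
Hypothesis ctrl1 : 1%:M = \sum_(k < N1) A1 ^+ k *m B1 *m X1 k.
Hypothesis obs1 : 1%:M = \sum_(k < N2) X2 k *m (K1 *m A1 ^+ k).
Hypothesis dc_gain : forall z y u, z != 0 -> y = H 0 *m z -> u = G 0 *m y ->
  complex.Re (dotc y u) < complex.Re (dotc z y).

Lemma feedback_stable s : 0 <= complex.Re s -> s%:M - feedback \in unitmx.
Proof.
move=> s_ge0; apply: contraT => /nonunit_kernel[x x0].
rewrite -[x]vsubmxK; set x1 := usubmx x; set x2 := dsubmx x => eqx.
(* As [D1 D2 = D2 D1 = 0], the algebraic loop is solved explicitly for the signals. *)
pose u := K1 *m x1 + D1 *m K2 *m x2; pose y := K2 *m x2 + D2 *m K1 *m x1.
have [uA2 [D2h H0h] axH] := sniH; have [uA1 u0 [D1h G0h] axG poleG] := niG.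
have uE : u = K1 *m x1 + D1 *m y + 0.
  by rewrite addr0 /y mulmxDr !mulmxA D12 !mul0mx addr0.
have yE : y = K2 *m x2 + D2 *m u by rewrite /u mulmxDr !mulmxA D21 !mul0mx
  addr0.
have [|e1 e2] := (feedback_equations s uE yE).1.
  by rewrite eqx !mulmx0 col_mx0.
have yH : y = H s *m u by rewrite yE (tfun_state _ _ (uA2 s s_ge0) e2).
have u_neq0 : u != 0.
  apply: contraNneq x0 => u_eq0.
  have y_eq0 : y = 0 by rewrite yH u_eq0 mulmx0.
  have x2_eq0 : x2 = 0.
    by apply: unit_kernel (uA2 s s_ge0) _; rewrite e2 u_eq0 mulmx0.
  have x1_eq0 : x1 = 0.
    apply: (observable_eigenvector (s := s) obs1).
      by rewrite e1 y_eq0 mulmx0.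
    by rewrite -u_eq0 uE y_eq0 mulmx0 !addr0.
  by rewrite -[x]vsubmxK -/x1 -/x2 x1_eq0 x2_eq0 col_mx0.
have uK : u = K1 *m x1 + D1 *m y by rewrite uE addr0.
exfalso; move: s_ge0; rewrite le_eqVlt => /orP[/eqP s0|s0].
  have sE : s = jomega (complex.Im s) by case: (s) s0 => a b /= <-.
  have [w0|w0] := eqVneq (complex.Im s) 0; last first.
    (* The supply rates of the two systems are opposite up to conjugation, but that of [H] is
       strict. *)
    have := ni_axis_state niG ctrl1 w0 (x := x1) (u := y).
    rewrite -sE -uK => /(_ e1); rewrite Im_dotcC yH mulrN oppr_le0 leNgt.
    by rewrite sE axH.
  have s_eq0 : s = 0 by rewrite sE w0.
  have uG : u = G 0 *m y by rewrite uK -s_eq0 (tfun_state _ _ _ e1) // s_eq0.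
  have yH0 : y = H 0 *m u by rewrite yH s_eq0.
  by have := dc_gain u_neq0 yH0 uG; rewrite (Re_dotcC y u) ltxx.
have uG : u = G s *m y by rewrite uK (tfun_state _ _ (uA1 s s0) e1).
have uH0 : H 0 \in unitmx.
  apply: contraT => /nonunit_kernel[z z0 Hz].
  by have := sni_dc_gt0 sniH D2_ge0 z0; rewrite -/(H 0) Hz dotc0r ltxx.
pose z := invmx (H 0) *m y.
have zE : H 0 *m z = y by rewrite /z mulKVmx.
have z0 : z != 0.
  apply: contraNneq u_neq0 => z_eq0.
  by rewrite uG -zE z_eq0 !mulmx0.
have h1 := sni_inverse_passive sniH D2_ge0 s0 zE (esym yH).
have h2 := ni_passive niG s0 uG (erefl (G 0 *m y)).
have := le_trans h1 h2; rewrite ler_pM2r ?Re_inv_gt0 // leNgt.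
by rewrite (dc_gain z0 (esym zE) (erefl _)).
Qed.
End Sufficiency.

Section Necessity.
Hypothesis stable : forall s, 0 <= complex.Re s -> s%:M - feedback \in unitmx.

(** [Bf], [Kf] and [D2] realize the map from the external input [v] to the output of [H]. *)
Let Bf : 'M[C]_(n1 + n2, m) := col_mx (B1 *m D2) B2.
Let Kf : 'M[C]_(m, n1 + n2) := row_mx (D2 *m K1) K2.
Let W := tfun feedback Bf Kf D2.

(** Describes [W s] by the loop signals, without inverting [1 - H G]. *)
Let W_output s (v : 'cV[C]_m) : 0 <= complex.Re s -> s%:M - A1 \in unitmx ->
  exists u y : 'cV[C]_m, [/\ W s *m v = y, y = H s *m u & v = u - G s *m y].
Proof.
move=> s0 uA1; have [uA2 _ _] := sniH.
pose x := invmx (s%:M - feedback) *m (Bf *m v).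
pose x1 := usubmx x; pose x2 := dsubmx x.
have xE : x = col_mx x1 x2 by rewrite vsubmxK.
pose u := K1 *m x1 + D1 *m K2 *m x2 + v.
pose y := K2 *m x2 + D2 *m K1 *m x1 + D2 *m v.
have uE : u = K1 *m x1 + D1 *m y + v.
  by rewrite /y !mulmxDr !mulmxA D12 !mul0mx !addr0.
have yE : y = K2 *m x2 + D2 *m u.
  by rewrite /u !mulmxDr !mulmxA D21 !mul0mx addr0 addrA.
have [|e1 e2] := (feedback_equations s uE yE).1.
  by rewrite -xE /x mulKVmx ?stable // /Bf mul_col_mx.
exists u, y; split.
- rewrite /W !tfunE mulmxDl -!mulmxA -/x xE /Kf mul_row_col /y.
  by rewrite [X in X + _ = _]addrC.
- by rewrite yE (tfun_state _ _ (uA2 s s0) e2).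
- by rewrite -[G s *m y](tfun_state _ _ uA1 e1) uE addrAC subrr add0r.
Qed.

(** Supply rates add up, so [W] inherits the axis inequality. *)
Let W_form_Im s (v u y : 'cV[C]_m) : y = H s *m u -> v = u - G s *m y ->
    complex.Im (dotc v y) =
  complex.Im (dotc u (H s *m u)) + complex.Im (dotc y (G s *m y)).
Proof. by move=> <- ->; rewrite dotcBl ImB (Im_dotcC y (G s *m y)) opprK. Qed.

Lemma feedback_dc_ge0 v : 0 <= complex.Re (dotc v (W 0 *m v)).
Proof.
have [uA2 [D2h H0h] axH] := sniH; have [uA1 u0 [D1h G0h] axG poleG] := niG.
have one_gt0 : 0 < complex.Re (1 : C) by exact: ltr01.
have Re00 : 0 <= complex.Re (0 : C) by [].
(* The exceptional points are the axis eigenvalues of [A1], where [W_output] does not apply. *)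
pose r := char_poly A1.
have r0 : r != 0 by rewrite monic_neq0 ?char_poly_monic.
have ax w : w != 0 -> r.[jomega w] != 0 ->
    w * complex.Im (dotc v (W (jomega w) *m v)) <= 0.
  move=> w0; rewrite -resolvent_unit => uw.
  have Rej : 0 <= complex.Re (jomega w : C) by [].
  have [u [y [-> yE vE]]] := W_output v Rej uw.
  have Hu : w * complex.Im (dotc u (H (jomega w) *m u)) <= 0.
    by have [->|uz] := eqVneq u 0; [rewrite dotc0l mulr0|exact/ltW/axH].
  have := lerD Hu (axG w y w0 uw); rewrite addr0 -mulrDr.
  by rewrite -(W_form_Im yE vE).
have W0 : complex.Im (dotc v (W 0 *m v)) = 0.
  have [u [y [-> yE vE]]] := W_output v Re00 u0.
  by rewrite (W_form_Im yE vE) !hermitian_Im0 // addr0.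
have h1 := ni_positive_real r0 stable (hermitian_Im0 v D2h) ax one_gt0.
have [h2 _] := ni_positive_real_inv r0 (fun s s0 =>
  stable (ltW s0)) (stable Re00)
  W0 (fun w w0 _ => ax w w0)
  (fun w w0 nu => False_ind _ (elimT negP nu (stable (lexx 0 : 0 <= complex.Re
    (jomega w))))) one_gt0.
rewrite mul1r mulmxBl dotcBr ReB subr_ge0 in h1.
rewrite divr1 mulmxBl dotcBr ReB subr_le0 in h2.
exact: (le_trans (D2_ge0 v) (le_trans h1 h2)).
Qed.

Lemma stable_dc_gain (x : R) : x%:C%:M - G 0 *m H 0 \notin unitmx -> x < 1.
Proof.
move=> /nonunit_kernel[u u_neq0]; rewrite mulmxBl mul_scalar_mx => /eqP.
rewrite subr_eq0 => /eqP GHu.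
have [uA2 [D2h H0h] axH] := sniH; have [uA1 u0 [D1h G0h] axG poleG] := niG.
have Re00 : 0 <= complex.Re (0 : C) by [].
(* The constant input [v] holds the closed loop at the equilibrium [x1, x2],
   whose output is [y]. *)
pose y := H 0 *m u; pose v := (1 - x)%:C *: u.
pose x1 := invmx (0%:M - A1) *m (B1 *m y);
  pose x2 := invmx (0%:M - A2) *m (B2 *m u).
have e1 : (0%:M - A1) *m x1 = B1 *m y by rewrite mulKVmx.
have e2 : (0%:M - A2) *m x2 = B2 *m u by rewrite mulKVmx ?uA2.
have yE : y = K2 *m x2 + D2 *m u by rewrite (tfun_state _ _ (uA2 0 Re00) e2).
have uE : u = K1 *m x1 + D1 *m y + v.
  rewrite (tfun_state _ _ u0 e1) -/(G 0) /y mulmxA -GHu -scalerDl -rmorphD /=.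
  by rewrite addrC subrK scale1r.
have e := (feedback_equations 0 uE yE).2 (conj e1 e2).
have xE : col_mx x1 x2 = invmx (0%:M - feedback) *m (Bf *m v).
  by apply: (canRL (mulKmx (stable Re00))); rewrite e /Bf mul_col_mx.
have Wv : W 0 *m v = y.
  have D2u : D2 *m u = D2 *m K1 *m x1 + D2 *m v.
    by rewrite {1}uE !mulmxDr !mulmxA D21 !mul0mx addr0.
  rewrite /W !tfunE mulmxDl -!mulmxA -xE /Kf mul_row_col yE D2u addrA.
  by rewrite [X in _ = X + _]addrC.
have := feedback_dc_ge0 v; rewrite Wv /v dotcZl conjc_real Re_realM.
rewrite pmulr_lge0; last exact: sni_dc_gt0 sniH D2_ge0 _ u_neq0.
rewrite subr_ge0 le_eqVlt => /orP[/eqP x1E|//].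
(* For [x = 1] the input vanishes, so the stable loop is at rest and [u = D1 D2 u = 0]. *)
have v0 : v = 0 by rewrite /v x1E subrr scale0r.
have := xE; rewrite v0 !mulmx0 -col_mx0 => /eq_col_mx[x1_eq0 x2_eq0].
move: u_neq0; rewrite uE yE x1_eq0 x2_eq0 v0 !mulmx0 !add0r addr0.
by rewrite mulmxA D12 mul0mx eqxx.
Qed.
End Necessity.
End Feedback.

(** * The DC gain condition *)

Section DcGain.
Variables (R : realType) (m : nat).
Notation C := R[i].
Implicit Types (P Q : 'M[C]_m).

Lemma spectral_decomposition P : P^t* = P ->
  exists U (d : 'rV[R]_m), [/\ U^t* *m U = 1%:M, U *m U^t* = 1%:M &
    P = U^t* *m diag_mx (map_mx (real_complex R) d) *m U].
Proof.
move=> Ph.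
have hP : P \is hermsymmx by apply/is_hermitianmxP; rewrite expr0 scale1r Ph.
have PE := @orthomx_spectralP _ _ P (hermitian_normalmx hP).
have dreal := hermitian_spectral_diag_real hP.
have uU := spectral_unitarymx P.
exists (spectralmx P), (\row_j complex.Re (spectral_diag P 0 j)); split.
- by rewrite -invmx_unitary // mulVmx // spectral_unit.
- exact/unitarymxP.
- have dE : map_mx (real_complex R) (\row_j complex.Re (spectral_diag P 0 j)) =
      spectral_diag P.
    apply/rowP => j; rewrite !mxE RRe_real //.
    by move/mxOverP: dreal; apply.
  by rewrite dE -(invmx_unitary uU); exact: PE.
Qed.

Lemma dotc_diag (d : 'rV[R]_m) (x : 'cV[C]_m) :
  complex.Re (dotc x (diag_mx (map_mx (real_complex R) d) *m x)) =
  \sum_j d 0 j * complex.Re ((x j 0)^*%C * x j 0).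
Proof.
rewrite dotcE (big_morph _ (@ReD R) (erefl : complex.Re (0 : C) = 0)).
apply: eq_bigr => j _; rewrite mul_diag_mx !mxE mulrCA Re_realM //.
Qed.

Lemma spectral_eigenvector P (U : 'M[C]_m) (d : 'rV[R]_m) j :
  U *m U^t* = 1%:M -> P = U^t* *m diag_mx (map_mx (real_complex R) d) *m U ->
  let p := U^t* *m delta_mx j 0 : 'cV[C]_m in
  p != 0 /\ P *m p = (d 0 j)%:C *: p.
Proof.
move=> U2 PE p; have Up : U *m p = delta_mx j 0 by rewrite /p mulmxA U2 mul1mx.
split.
  apply/eqP => p0; have /matrixP/(_ j 0) := Up; rewrite p0 mulmx0 !mxE !eqxx.
  by move/eqP; rewrite eq_sym oner_eq0.
rewrite PE -!mulmxA Up /p scalemxAr; congr (_ *m _).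
apply/matrixP => i k; rewrite mul_diag_mx !mxE.
by case: eqP => [->|_] //=; rewrite !mulr0.
Qed.

(** If all eigenvalues were below 1, the sum of [(1 - d_j) |q'_j|^2] over the spectral coordinates
    would be positive. *)
Lemma hermitian_eigenvalue_ge1 P q : P^t* = P -> q != 0 ->
  complex.Re (dotc q q) <= complex.Re (dotc q (P *m q)) ->
  exists2 e : R, 1 <= e & exists2 p : 'cV[C]_m, p != 0 & P *m p = e%:C *: p.
Proof.
move=> Ph q0 hq; have [U [d [U1 U2 PE]]] := spectral_decomposition Ph.
have [[j dj]|h] := pselect (exists j, 1 <= d 0 j).
  have [p0 Pp] := spectral_eigenvector j U2 PE.
  by exists (d 0 j) => //; exists (U^t* *m delta_mx j 0).
exfalso; pose q' := U *m q.
have q'0 : q' != 0.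
  apply: contraNneq q0 => q'0.
  by rewrite -[q]mul1mx -U1 -mulmxA -/q' q'0 mulmx0.
have E1 : complex.Re (dotc q q) = \sum_j complex.Re ((q' j 0)^*%C * q' j 0).
  rewrite -[X in dotc _ X]mul1mx -U1 -mulmxA -[U in U^t* *m _]trmxCK -dotc_mull.
  rewrite trmxCK -/q' dotcE.
  by rewrite (big_morph _ (@ReD R) (erefl : complex.Re (0 : C) = 0)).
have E2 : complex.Re (dotc q (P *m q)) =
    \sum_j d 0 j * complex.Re ((q' j 0)^*%C * q' j 0).
  by rewrite -dotc_diag PE -!mulmxA -dotc_mull.
have a0 j : 0 <= complex.Re ((q' j 0)^*%C * q' j 0).
  by have := mulcJ_ge0 (q' j 0); rewrite mulrC lecE => /andP[].
have d1 j : d 0 j < 1 by rewrite ltNge; apply/negP => dj; apply: h; exists j.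
have t0 j : 0 <= (1 - d 0 j) * complex.Re ((q' j 0)^*%C * q' j 0).
  by rewrite mulr_ge0 // subr_ge0 ltW.
have : \sum_j (1 - d 0 j) * complex.Re ((q' j 0)^*%C * q' j 0) = 0.
  apply/eqP; rewrite eq_le sumr_ge0 // andbT.
  under eq_bigr do rewrite mulrBl mul1r.
  by rewrite sumrB subr_le0 -E1 -E2.
move=> /(psumr_eq0P (fun j _ => t0 j)) z; move/eqP: q'0; apply.
apply/matrixP => j k; rewrite ord1 [RHS]mxE.
have /eqP := z j isT; rewrite mulf_eq0 subr_eq0 gt_eqF //=.
case: (q' j 0) => a b; rewrite /= mulNr opprK => /eqP ab.
have := sqr_ge0 a; have := sqr_ge0 b; rewrite !expr2 => b0 a'0.
have /eqP : a * a = 0 by lra.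
have /eqP : b * b = 0 by lra.
by rewrite !mulf_eq0 !orbb => /eqP -> /eqP ->.
Qed.

Lemma sqrt_decomposition P : P^t* = P ->
  (forall y, y != 0 -> 0 < complex.Re (dotc y (P *m y))) ->
  exists L, L \in unitmx /\ P = L *m L^t*.
Proof.
move=> Ph Ppos; have [U [d [U1 U2 PE]]] := spectral_decomposition Ph.
have d0 j : 0 < d 0 j.
  have [p0 Pp] := spectral_eigenvector j U2 PE.
  have := Ppos _ p0; rewrite Pp dotcZr Re_realM pmulr_lgt0 //.
  exact: dotc_gt0.
have uP : P \in unitmx.
  apply: contraT => /nonunit_kernel[y y0 Py].
  by have := Ppos y y0; rewrite Py dotc0r ltxx.
pose r : 'rV[C]_m := \row_j (Num.sqrt (d 0 j))%:C.
have rr : diag_mx r *m (diag_mx r)^t* = diag_mx (map_mx (real_complex R) d).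
  rewrite tr_diag_mx map_diag_mx mulmx_diag; congr diag_mx.
  apply/rowP => j; rewrite !mxE [X in _ * X]conjc_real -rmorphM /= -expr2.
  by rewrite sqr_sqrtr // ltW.
have PL : P = (U^t* *m diag_mx r) *m (U^t* *m diag_mx r)^t*.
  by rewrite trmx_mul map_mxM trmxCK mulmxA -[_ *m _ *m (diag_mx r)^t*]mulmxA
    rr.
move: (U^t* *m diag_mx r) PL => L PL; exists L; split; last exact: PL.
by move: uP; rewrite PL unitmx_mul => /andP[].
Qed.

(** With [P = L L^*] and [q = L^* z], failure of the inequality bounds a Rayleigh quotient of
    [L^* Q L] below by 1. *)
Lemma dc_gain_lt P Q : P^t* = P -> Q^t* = Q ->
  (forall y, y != 0 -> 0 < complex.Re (dotc y (P *m y))) ->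
  (forall x : R, x%:C%:M - Q *m P \notin unitmx -> x < 1) ->
  forall z, z != 0 ->
    complex.Re (dotc (P *m z) (Q *m (P *m z))) < complex.Re (dotc z (P *m z)).
Proof.
move=> Ph Qh Ppos eigs z z0; rewrite ltNge; apply/negP => hz.
have [L [uL PE]] := sqrt_decomposition Ph Ppos.
pose q := L^t* *m z.
have uLt : L^t* \in unitmx by rewrite map_unitmx unitmx_tr.
have q0 : q != 0.
  by apply: contraNneq z0 => /(unit_kernel uLt) ->.
pose M := L^t* *m Q *m L.
have Mh : M^t* = M.
  by rewrite /M !trmx_mul !map_mxM trmxCK Qh mulmxA.
have [|e e1 [p p0 Mp]] := hermitian_eigenvalue_ge1 Mh q0.
  have -> : dotc q q = dotc z (P *m z) by rewrite {1}/q dotc_mull trmxCK PE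
    mulmxA.
  have -> // : dotc q (M *m q) = dotc (P *m z) (Q *m (P *m z)).
  by rewrite {1}/q !dotc_mull trmxCK Ph PE /M !mulmxA.
have : e%:C%:M - Q *m P \notin unitmx.
  apply/negP => ue; have e0 : e%:C != 0 :> C.
    by rewrite (inj_eq (@complexI R)) gt_eqF // (lt_le_trans ltr01).
  (* [Q L] carries eigenvectors of [L^* Q L] to eigenvectors of [Q P]; the image is nonzero because
     [e] is. *)
  have QLp : Q *m L *m p = 0.
    apply: (unit_kernel ue); rewrite mulmxBl mul_scalar_mx PE.
    have -> : Q *m (L *m L^t* ) *m (Q *m L *m p) = Q *m L *m (M *m p).
      by rewrite /M !mulmxA.
    by rewrite Mp scalemxAr subrr.
  have : M *m p = 0.
    by rewrite /M -[L^t* *m Q *m L]mulmxA -[L^t* *m _ *m p]mulmxA QLp mulmx0.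
  by rewrite Mp => /eqP; rewrite scaler_eq0 (negPf e0) (negPf p0).
by move=> /eigs; rewrite ltNge e1.
Qed.
End DcGain.

Section LambdaMax.
Variables (R : realType) (m : nat).
Notation C := R[i].

Lemma eigenvalue_nonunit (X : 'M[C]_m) s : eigenvalue X s =
    (s%:M - X \notin unitmx).
Proof. by rewrite resolvent_unit negbK eigenvalue_root_char. Qed.

Lemma lambda_max_lt1 (X : 'M[C]_m) :
  lambda_max X < 1 <-> forall x : R, x%:C%:M - X \notin unitmx -> x < 1.
Proof.
rewrite /lambda_max; set E := [set x : R | _].
have EE x : E x <-> x%:C%:M - X \notin unitmx by rewrite /E /=
  eigenvalue_nonunit.
have [r rE] := closed_field_poly_normal (char_poly X).
have memE x : E x -> x \in map (@complex.Re R) r.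
  rewrite /E /= eigenvalue_root_char rE rootZ.
    by rewrite root_prod_XsubC => xr; apply/mapP; exists x%:C.
  by rewrite lead_coef_eq0 monic_neq0 ?char_poly_monic.
have ubE : ubound E (\big[Num.max/0]_(x <- map (@complex.Re R) r) x).
  move=> x /memE xr; exact: (le_bigmax_seq 0 x xpredT id xr isT).
split=> [lt1 x /EE xE|h].
  apply: le_lt_trans lt1; apply: ub_le_sup => //.
  by exists (\big[Num.max/0]_(x <- map (@complex.Re R) r) x).
(* Without real eigenvalues, for instance if [m = 0], the supremum is 0 by convention. *)
have [->|/set0P E0] := eqVneq E set0; first by rewrite sup0.
(* Only real eigenvalues enter, since [h] bounds no other real parts; the initial value 0 is below
   1. *)
pose k := \big[Num.max/0]_(x <- [seq x <- map (@complex.Re R) r | `[< E x >]])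
  x.
have k1 : k < 1.
  rewrite /k big_filter; elim/big_ind: _ => [|x y x1 y1|x /asboolP /EE /h //].
    exact: ltr01.
  by rewrite gt_max x1 y1.
apply: le_lt_trans k1; apply: ge_sup => // x xE.
by apply: (le_bigmax_seq 0 x xpredT id _ isT);
  rewrite mem_filter memE // andbT; apply/asboolP.
Qed.
End LambdaMax.

Theorem corollary1 (R : realType) (m : nat) (G H : tfmatrix R m)
    (n1 n2 : nat) (S1 : state_space R m n1) (S2 : state_space R m n2)
    (minS1 : minimal_realization S1 G) (minS2 : minimal_realization S2 H)
    (properG : tf_proper G) (niG : negative_imaginary G)
    (properH : tf_proper H) (sniH : strictly_negative_imaginary H)
    (GHinf : (tf_infty G *m tf_infty H = 0)%R) (Hinf : psdmx (tf_infty H)) :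
  internally_stable S1 S2 <->
  (lambda_max (tf_eval G 0 *m tf_eval H 0) < 1)%R.
Proof.
have ni1 := ni_realization minS1 niG.
have sni2 := sni_realization minS2 sniH.
have [SG _] := minS1; have [SH _] := minS2.
have [N1 [X1 ctrl1]] := minimal_controllableC minS1.
have [N2 [X2 obs1]] := minimal_observableC minS1.
have D1E : tf_infty G = map_mx (real_complex R) (ssD S1) by rewrite -SG
  tf_infinityE.
have D2E : tf_infty H = map_mx (real_complex R) (ssD S2) by rewrite -SH
  tf_infinityE.
rewrite D1E D2E in GHinf Hinf.
have [uA1 u1 [D1h G0h] _ _] := ni1; have [uA2 [D2h H0h] _] := sni2.
have u2 := uA2 0 (lexx _).
(* The adjoint of [D1 D2 = 0], as both factors are Hermitian. *)
have GHinf' : map_mx (real_complex R) (ssD S2) *m map_mx (real_complex R) (ssD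
  S1) = 0.
  have := congr1 (fun M => M^t* ) GHinf.
  by rewrite trmx_mul map_mxM D1h D2h trmx0 map_mx0.
have D2_ge0 y : 0 <= complex.Re (dotc y (map_mx (real_complex R) (ssD S2) *m
  y)).
  by have [_ /(_ y)] := psdmx_form Hinf; rewrite lecE => /andP[].
have G0E : tf_eval G 0 = ss_eval S1 0 by rewrite -SG (ss_evalE u1).2.
have H0E : tf_eval H 0 = ss_eval S2 0 by rewrite -SH (ss_evalE u2).2.
have clE : map_mx (real_complex R) (closed_loop S1 S2) =
    feedback (map_mx (real_complex R) (ssA S1)) (map_mx (real_complex R) (ssB
      S1))
      (map_mx (real_complex R) (ssC S1)) (map_mx (real_complex R) (ssD S1))
      (map_mx (real_complex R) (ssA S2)) (map_mx (real_complex R) (ssB S2))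
      (map_mx (real_complex R) (ssC S2)) (map_mx (real_complex R) (ssD S2)).
  by rewrite /closed_loop map_block_mx !map_mxD !map_mxM.
rewrite lambda_max_lt1 G0E H0E /internally_stable clE;
  split=> [stable x|eigs s].
  apply: (stable_dc_gain GHinf GHinf' ni1 sni2 D2_ge0) => s s0.
  by apply: contraT; rewrite -eigenvalue_nonunit => /stable; rewrite ltNge s0.
rewrite eigenvalue_nonunit ltNge; apply: contra => s0.
apply: (feedback_stable GHinf GHinf' ni1 sni2 D2_ge0 ctrl1 obs1);
  last exact: s0.
move=> z y u z0 -> ->; apply: (dc_gain_lt H0h G0h _ eigs z0) => y'.
exact: (sni_dc_gt0 sni2 D2_ge0).
Qed.
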